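(* Let $n$ be a positive integer. Let $P_n(m;u_0,\dots,u_{n-1};v_0,\dots,v_{n-1})$ be the number of partitions of $m$ in $\mathcal{P}_n$ such that for each $i\in\{0,\dots,n-1\}$ the symbol $a_i$ (resp. $b_i$) appears $u_i$ (resp. $v_i$) times in the colours of the parts, and let $F_n(m;u_0,\dots,u_{n-1};v_0,\dots,v_{n-1})$ be the number of $n^2$-coloured Frobenius partitions of weight $m$ in which, for each $i$, the symbol $a_i$ (resp. $b_i$) appears $u_i$ (resp. $v_i$) times. Then, as formal power series in $q$, $$\sum_{m,u_i,v_i\ge0}P_n(m;u;v)\,q^m\prod_{i=0}^{n-1}a_i^{u_i-v_i}=\sum_{m,u_i,v_i\ge0}F_n(m;u;v)\,q^m\prod_{i=0}^{n-1}a_i^{u_i-v_i}=[x^0]\prod_{i=0}^{n-1}(-xa_iq;q)_\infty(-x^{-1}a_i^{-1};q)_\infty.$$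
   Context: $(a;q)_\infty=\prod_{j\ge0}(1-aq^j)$; $[x^0]$ denotes the coefficient of $x^0$. Colours are symbols $a_ib_k$ with $0\le i,k\le n-1$, the colour $a_ib_k$ containing symbol $a_i$ once and $b_k$ once. With $\chi(P)\in\{0,1\}$ the truth value of $P$, $\Delta(a_ib_k,a_{i'}b_{k'})=\chi(i\ge i')-\chi(i=k=i')+\chi(k\le k')-\chi(k=i'=k')$. $\mathcal{P}_n$ is the set of coloured partitions $\lambda_1+\dots+\lambda_s$ (positive integer parts with colours $c(\lambda_j)$ among the $a_ib_k$) with $\lambda_j-\lambda_{j+1}\ge\Delta(c(\lambda_j),c(\lambda_{j+1}))$ for all $j$. An $n^2$-coloured Frobenius partition is an array $\begin{pmatrix}\lambda_1&\cdots&\lambda_s\\ \mu_1&\cdots&\mu_s\end{pmatrix}$ with $\lambda_1>\dots>\lambda_s$ non-negative integers each coloured by some $a_i$, strictly decreasing for the order $0_{a_{n-1}}<\dots<0_{a_0}<1_{a_{n-1}}<\dots<1_{a_0}<\cdots$, and $\mu_1>\dots>\mu_s$ non-negative integers each coloured by some $b_i$, strictly decreasing for the order $0_{b_0}<\dots<0_{b_{n-1}}<1_{b_0}<\dots<1_{b_{n-1}}<\cdots$; its weight is $s+\sum\lambda_j+\sum\mu_j$; the symbol $a_i$ (resp. $b_i$) appears once for each part of $\lambda$ (resp. $\mu$) coloured $a_i$ (resp. $b_i$). *)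

(* Defs.v *)
From HB Require Import structures.
From mathcomp Require Import all_boot all_order all_algebra.
From mathcomp Require Import finmap monalg.
From mathcomp Require Import boolp classical_sets functions cardinality fsbigop.

Set Implicit Arguments.
Unset Strict Implicit.
Unset Printing Implicit Defensive.

Import Order.TTheory GRing.Theory Num.Theory.
Local Open Scope classical_set_scope.
Local Open Scope ring_scope.

(* Group algebra R[G] of an abelian group G written additively: a copy of
   {malg R[G]} (finitely supported functions G -> R) with the convolution
   product. monalg's own ring structure on malg requires a monoid without
   nontrivial units, which excludes Laurent polynomials. *)
Definition galg (R : comNzRingType) (G : zmodType) : Type := malg G R.

HB.instance Definition _ (R : comNzRingType) (G : zmodType) :=
  GRing.Zmodule.on (galg R G).

Section GroupAlgebra.
Variables (R : comNzRingType) (G : zmodType).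
Implicit Types (f g h : galg R G) (k l : G) (c : R).

Definition gmon c k : galg R G := mkmalgU k c.
Definition gcoef k f : R := mcoeff k f.

Definition gone : galg R G := gmon 1 0.
Definition gmul f g : galg R G :=
  \sum_(k <- msupp f) \sum_(l <- msupp g) gmon (gcoef k f * gcoef l g) (k + l).

Lemma galgP f g : (forall k, gcoef k f = gcoef k g) -> f = g.
Proof. by move=> e; apply/malgP. Qed.

Fact gcoef_is_additive k : zmod_morphism (gcoef k).
Proof. exact: mcoeffB. Qed.
HB.instance Definition _ k :=
  GRing.isZmodMorphism.Build (galg R G) R (gcoef k) (gcoef_is_additive k).

Lemma gmon0 k : gmon 0 k = 0.
Proof. exact: monalgU0. Qed.

Lemma gmonD k c d : gmon (c + d) k = gmon c k + gmon d k.
Proof. exact: monalgUD. Qed.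

Lemma gcoef_mon c k l : gcoef l (gmon c k) = c *+ (k == l).
Proof. exact: mcoeffU. Qed.

Lemma gcoef_out f k : k \notin msupp f -> gcoef k f = 0.
Proof. exact: mcoeff_outdom. Qed.

Lemma galgE f : f = \sum_(k <- msupp f) gmon (gcoef k f) k.
Proof. exact: monalgE. Qed.

Lemma gmulEw (d1 d2 : {fset G}) f g :
  (msupp f `<=` d1)%fset -> (msupp g `<=` d2)%fset ->
  gmul f g =
    \sum_(k <- d1) \sum_(l <- d2) gmon (gcoef k f * gcoef l g) (k + l).
Proof.
move=> le1 le2; rewrite /gmul (big_fset_incl _ le1) /=; last first.
  move=> k _ /gcoef_out fk; rewrite big1 // => l _.
  by rewrite fk mul0r gmon0.
apply: eq_bigr => k _; apply: big_fset_incl => // l _ /gcoef_out ->.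
by rewrite mulr0 gmon0.
Qed.

Fact gmulC : commutative gmul.
Proof.
move=> f g; rewrite /gmul exchange_big /=; apply: eq_bigr => k _.
by apply: eq_bigr => l _; rewrite mulrC addrC.
Qed.

Fact gmulDl : left_distributive gmul +%R.
Proof.
move=> f g h; rewrite (@gmulEw _ _ f h (fsubsetUl _ (msupp g)) (fsubset_refl _)).
rewrite (@gmulEw _ _ g h (fsubsetUr (msupp f) _) (fsubset_refl _)).
rewrite (@gmulEw _ _ (f + g) h (msuppD_le _ _) (fsubset_refl _)) -big_split /=.
apply: eq_bigr => k _; rewrite -big_split /=; apply: eq_bigr => l _.
by rewrite raddfD /= mulrDl gmonD.
Qed.

Lemma gmul0 f : gmul 0 f = 0.
Proof. by rewrite /gmul msupp0 big_seq_fset0. Qed.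

Lemma gmul_suml (I : Type) (r : seq I) (F : I -> galg R G) f :
  gmul (\sum_(i <- r) F i) f = \sum_(i <- r) gmul (F i) f.
Proof. exact: (big_morph (gmul^~ f) (fun _ _ => gmulDl _ _ _) (gmul0 _)). Qed.

Lemma gmul_sumr (I : Type) (r : seq I) (F : I -> galg R G) f :
  gmul f (\sum_(i <- r) F i) = \sum_(i <- r) gmul f (F i).
Proof. by rewrite gmulC gmul_suml; apply: eq_bigr => i _; rewrite gmulC. Qed.

Lemma gmulMM c d k l : gmul (gmon c k) (gmon d l) = gmon (c * d) (k + l).
Proof.
by rewrite (gmulEw msuppU_le msuppU_le) !big_seq_fset1 !gcoef_mon !eqxx.
Qed.

Fact gmul1 : left_id gone gmul.
Proof.
move=> f; rewrite {1}(galgE f) gmul_sumr [RHS]galgE.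
by apply: eq_bigr => k _; rewrite gmulMM mul1r add0r.
Qed.

Fact gmulA : associative gmul.
Proof.
move=> f g h; rewrite (galgE f) (galgE g) (galgE h).
rewrite !gmul_suml; apply: eq_bigr => k _.
rewrite gmul_sumr [in RHS](gmul_sumr (msupp g)) gmul_suml; apply: eq_bigr => l _.
rewrite !gmul_sumr; apply: eq_bigr => m _.
by rewrite !gmulMM mulrA addrA.
Qed.

Fact gone_neq0 : gone != 0.
Proof.
apply/eqP => /(congr1 (gcoef 0)); rewrite gcoef_mon eqxx raddf0 /=.
by apply/eqP; rewrite oner_eq0.
Qed.

HB.instance Definition _ := GRing.Zmodule_isComNzRing.Build (galg R G)
  gmulA gmulC gmul1 gmulDl gone_neq0.

Definition gunit : pred (galg R G) := fun f => `[< exists g, g * f = 1 >].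
Definition ginv f : galg R G := xget f [set g | g * f = 1].

Fact gmulVr : {in gunit, left_inverse 1 ginv *%R}.
Proof.
move=> f /asboolP[g gf]; rewrite /ginv.
exact: (@xgetPex _ f [set g | g * f = 1] (ex_intro _ g gf)).
Qed.

Fact gunitPl f g : g * f = 1 -> gunit f.
Proof. by move=> gf; apply/asboolP; exists g. Qed.

Fact ginv_out : {in predC gunit, ginv =1 id}.
Proof.
move=> f /= nf; rewrite /ginv; case: xgetP => // g _ gf.
by move: nf; rewrite unfold_in /= (gunitPl gf).
Qed.

HB.instance Definition _ := GRing.ComNzRing_hasMulInverse.Build (galg R G)
  gmulVr gunitPl ginv_out.

Lemma gmonM c d k l : gmon c k * gmon d l = gmon (c * d) (k + l).
Proof. exact: gmulMM. Qed.

Lemma gmonV k : (gmon 1 k)^-1 = gmon 1 (- k).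
Proof.
have e : gmon 1 (- k) * gmon 1 k = 1 by rewrite gmonM mulr1 addNr.
have u : gmon 1 k \is a GRing.unit := gunitPl e.
by apply: (mulIr u); rewrite mulVr.
Qed.

End GroupAlgebra.

(* Formal power series in one variable, the sequence of coefficients being
   wrapped so that the product is not the pointwise one. *)
Record fps (R : Type) : Type := Fps { fcoef : nat -> R }.

HB.instance Definition _ (R : Type) := gen_eqMixin (fps R).
HB.instance Definition _ (R : Type) := gen_choiceMixin (fps R).

Section PowerSeries.
Variable R : comNzRingType.
Implicit Types (f g h : fps R) (c : R) (p : {poly R}).

Lemma fpsP f g : (forall m, fcoef f m = fcoef g m) -> f = g.
Proof. by case: f g => [f] [g] /= /funext ->. Qed.

Definition fzero : fps R := Fps (fun=> 0).
Definition fopp f : fps R := Fps (fun m => - fcoef f m).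
Definition fadd f g : fps R := Fps (fun m => fcoef f m + fcoef g m).

Fact faddA : associative fadd.
Proof. by move=> f g h; apply: fpsP => m /=; rewrite addrA. Qed.
Fact faddC : commutative fadd.
Proof. by move=> f g; apply: fpsP => m /=; rewrite addrC. Qed.
Fact fadd0 : left_id fzero fadd.
Proof. by move=> f; apply: fpsP => m /=; rewrite add0r. Qed.
Fact faddN : left_inverse fzero fopp fadd.
Proof. by move=> f; apply: fpsP => m /=; rewrite addNr. Qed.

HB.instance Definition _ := GRing.isZmodule.Build (fps R)
  faddA faddC fadd0 faddN.

Definition fpsC c : fps R := Fps (fun m => c *+ (m == 0)%N).
Definition fpsX : fps R := Fps (fun m => (m == 1)%N%:R).

Definition fmul f g : fps R :=
  Fps (fun m => \sum_(i < m.+1) fcoef f i * fcoef g (m - i)%N).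

Definition ftrunc N f : {poly R} := \poly_(i < N) fcoef f i.

Lemma fmul_trunc N f g m : (m < N)%N ->
  fcoef (fmul f g) m = (ftrunc N f * ftrunc N g)`_m.
Proof.
move=> lt_mN; rewrite coefM /=; apply: eq_bigr => i _; rewrite !coef_poly.
have -> : (i < N)%N by rewrite (leq_trans _ lt_mN).
by have -> : (m - i < N)%N by rewrite (leq_ltn_trans (leq_subr _ _) lt_mN).
Qed.

Lemma coefM_eq N p p' (r r' : {poly R}) m : (m < N)%N ->
  (forall i, (i < N)%N -> p`_i = p'`_i) ->
  (forall i, (i < N)%N -> r`_i = r'`_i) -> (p * r)`_m = (p' * r')`_m.
Proof.
move=> lt_mN ep er; rewrite !coefM; apply: eq_bigr => i _.
rewrite ep ?er // ?(leq_ltn_trans (leq_subr _ _) lt_mN) //.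
by rewrite (leq_trans _ lt_mN).
Qed.

Lemma coef_ftrunc N f i : (i < N)%N -> (ftrunc N f)`_i = fcoef f i.
Proof. by rewrite coef_poly => ->. Qed.

Fact fmulA : associative fmul.
Proof.
move=> f g h; apply: fpsP => m; rewrite !(@fmul_trunc m.+1) //.
pose t := ftrunc m.+1.
transitivity ((t f * (t g * t h))`_m); last rewrite mulrA; last symmetry.
  by apply: (@coefM_eq m.+1) => // i lt_im; rewrite coef_ftrunc // -fmul_trunc.
by apply: (@coefM_eq m.+1) => // i lt_im; rewrite coef_ftrunc // -fmul_trunc.
Qed.

Fact fmulC : commutative fmul.
Proof.
by move=> f g; apply: fpsP => m; rewrite !(@fmul_trunc m.+1) // mulrC.
Qed.

Fact fmul1 : left_id (fpsC 1) fmul.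
Proof.
move=> f; apply: fpsP => m /=; rewrite big_ord_recl /= subn0 mul1r big1 ?addr0 //.
by move=> i _; rewrite mul0r.
Qed.

Fact fmulDl : left_distributive fmul +%R.
Proof.
move=> f g h; apply: fpsP => m /=; rewrite -big_split /=.
by apply: eq_bigr => i _; rewrite mulrDl.
Qed.

Fact fone_neq0 : fpsC 1 != 0.
Proof.
apply/eqP => /(congr1 (fun f => fcoef f 0)) /= /eqP.
by rewrite mulr1n oner_eq0.
Qed.

HB.instance Definition _ := GRing.Zmodule_isComNzRing.Build (fps R)
  fmulA fmulC fmul1 fmulDl fone_neq0.

(* Coefficientwise sum; \sum_(i \in A) is the finite-support sum, equal to 0 on
   families with infinite support, so it is only used on summable families
   (see gf_P_summable and gf_F_summable). *)
Definition fps_sum (I : choiceType) (F : I -> fps R) : fps R :=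
  Fps (fun m => \sum_(i \in [set: I]) fcoef (F i) m).

Definition fps_summable (I : choiceType) (F : I -> fps R) : Prop :=
  forall m, finite_set [set i | fcoef (F i) m <> 0].

Definition fps_cvg (F : nat -> fps R) (f : fps R) : Prop :=
  forall m, exists N0, forall N, (N0 <= N)%N -> fcoef (F N) m = fcoef f m.

Definition fps_lim (F : nat -> fps R) : fps R := xget 0 [set f | fps_cvg F f].

(* (a; q)_oo, with q the variable fpsX *)
Definition qpoch_inf (a : fps R) : fps R :=
  fps_lim (fun N => \prod_(j < N) (1 - a * fpsX ^+ j)).

Lemma fps_cvg_unique F f g : fps_cvg F f -> fps_cvg F g -> f = g.
Proof.
move=> Ff Fg; apply: fpsP => m; have [N1 e1] := Ff m; have [N2 e2] := Fg m.
by rewrite -(e1 _ (leq_maxl N1 N2)) -(e2 _ (leq_maxr N1 N2)).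
Qed.

Lemma fps_limE F f : fps_cvg F f -> fps_lim F = f.
Proof.
move=> Ff; apply: (@fps_cvg_unique F) => //.
exact: (@xgetPex _ 0 [set f | fps_cvg F f] (ex_intro _ f Ff)).
Qed.

Lemma fcoefXM f m :
  fcoef (fpsX * f) m = if m is m'.+1 then fcoef f m' else 0.
Proof.
case: m => [|m] /=; first by rewrite big_ord_recl big_ord0 /= mul0r addr0.
rewrite 2!big_ord_recl /= mul0r add0r mul1r subSS subn0.
by rewrite big1 ?addr0 // => i _; rewrite mul0r.
Qed.

Lemma fcoefMX f j m : fcoef (f * fpsX ^+ j) m =
  if (m < j)%N then 0 else fcoef f (m - j)%N.
Proof.
elim: j m => [|j IHj] m; first by rewrite expr0 mulr1 ltn0 subn0.
rewrite exprSr mulrA mulrC fcoefXM.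
by case: m => [|m]; rewrite // IHj ltnS subSS.
Qed.

(* The truncation [j <= m] computes the coefficient of q^m. *)
Lemma qpoch_infP a :
  fps_cvg (fun N => \prod_(j < N) (1 - a * fpsX ^+ j))
    (Fps (fun m => fcoef (\prod_(j < m.+1) (1 - a * fpsX ^+ j)) m)).
Proof.
move=> m; exists m.+1; elim=> // N IHN; rewrite leq_eqVlt => /orP[/eqP <- //|].
rewrite ltnS => lt_mN; rewrite -(IHN lt_mN) big_ord_recr.
set P := \prod_(j < N) (1 - a * fpsX ^+ j).
transitivity (fcoef (P * (1 - a * fpsX ^+ N)) m); first by [].
have -> : P * (1 - a * fpsX ^+ N) = P - P * a * fpsX ^+ N.
  by rewrite mulrBr mulr1 mulrA.
have -> g h : fcoef (g - h) m = fcoef g m - fcoef h m by [].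
by rewrite fcoefMX lt_mN subr0.
Qed.

Lemma qpoch_infE a m : fcoef (qpoch_inf a) m =
  fcoef (\prod_(j < m.+1) (1 - a * fpsX ^+ j)) m.
Proof. by rewrite /qpoch_inf (fps_limE (qpoch_infP a)). Qed.

End PowerSeries.

Arguments fpsX {R}.

Definition fps_map (R S : Type) (phi : R -> S) (f : fps R) : fps S :=
  Fps (fun m => phi (fcoef f m)).

(* laurent n  = Z[a_0^{+-1}, ..., a_{n-1}^{+-1}],
   xlaurent n = (laurent n)[x^{+-1}]. *)
Definition laurent (n : nat) := galg int {ffun 'I_n -> int}.
Definition xlaurent (n : nat) := galg (laurent n) int.

Definition avar (n : nat) (i : 'I_n) : laurent n :=
  gmon 1 [ffun j => (j == i)%:Z].
Definition xvar (n : nat) : xlaurent n := gmon 1 1.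
Definition xconst (n : nat) (c : laurent n) : xlaurent n := gmon c 0.

Lemma avarV (n : nat) (i : 'I_n) :
  (avar i)^-1 = gmon 1 (- [ffun j => (j == i)%:Z]).
Proof. exact: gmonV. Qed.

Lemma xvarV (n : nat) : (xvar n)^-1 = gmon 1 (-1).
Proof. exact: gmonV. Qed.

Lemma xconst_avarV (n : nat) (i : 'I_n) :
  (xconst (avar i))^-1 = xconst (avar i)^-1.
Proof.
have e : gmon (avar i)^-1 0 * gmon (avar i) 0 = 1 :> xlaurent n.
  by rewrite gmonM addr0 avarV gmonM mulr1 addNr.
have u : xconst (avar i) \is a GRing.unit := gunitPl e.
by apply: (mulIr u); rewrite mulVr // -[RHS]e.
Qed.

(* The coefficient [x^0], applied to each coefficient in q. *)
Definition coefx0 (n : nat) (f : fps (xlaurent n)) : fps (laurent n) :=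
  fps_map (gcoef 0) f.

(* The colour (i, k) stands for a_i b_k. *)
Definition colour (n : nat) : Type := ('I_n * 'I_n)%type.

Definition chi (P : bool) : int := (nat_of_bool P)%:Z.

Definition Delta (n : nat) (c c' : colour n) : int :=
  let: (i, k) := c in let: (i', k') := c' in
  chi (i' <= i)%N - chi ((i == k) && (k == i'))
  + chi (k <= k')%N - chi ((k == i') && (i' == k')).

(* Partitions are the sequences of their coloured parts (size, colour). *)
Definition is_Pn (n : nat) (l : seq (nat * colour n)) : bool :=
  all (fun p => 0 < p.1)%N l
  && sorted (fun p p' => Delta p.2 p'.2 <= p.1%:Z - p'.1%:Z) l.

Definition Pn_weight (n : nat) (l : seq (nat * colour n)) : nat :=
  \sum_(p <- l) p.1.

Definition Pn_count_a (n : nat) (l : seq (nat * colour n)) :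
    {ffun 'I_n -> nat} :=
  [ffun i => count (fun p => p.2.1 == i) l].

Definition Pn_count_b (n : nat) (l : seq (nat * colour n)) :
    {ffun 'I_n -> nat} :=
  [ffun i => count (fun p => p.2.2 == i) l].

Definition gt_a (n : nat) (p p' : nat * 'I_n) : bool :=
  (p'.1 < p.1)%N || ((p'.1 == p.1) && (p.2 < p'.2)%N).

Definition gt_b (n : nat) (p p' : nat * 'I_n) : bool :=
  (p'.1 < p.1)%N || ((p'.1 == p.1) && (p'.2 < p.2)%N).

(* The pair of rows (lambda, mu). *)
Definition frob (n : nat) : Type := (seq (nat * 'I_n) * seq (nat * 'I_n))%type.

Definition is_frob (n : nat) (f : frob n) : bool :=
  [&& size f.1 == size f.2, sorted (@gt_a n) f.1 & sorted (@gt_b n) f.2].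

Definition frob_weight (n : nat) (f : frob n) : nat :=
  (size f.1 + \sum_(p <- f.1) p.1 + \sum_(p <- f.2) p.1)%N.

Definition frob_count_a (n : nat) (f : frob n) : {ffun 'I_n -> nat} :=
  [ffun i => count (fun p => p.2 == i) f.1].

Definition frob_count_b (n : nat) (f : frob n) : {ffun 'I_n -> nat} :=
  [ffun i => count (fun p => p.2 == i) f.2].

(* Number of elements of a finite set (0 on infinite sets; the sets counted
   below are finite by Pset_finite and Fset_finite). *)
Definition ncard (T : choiceType) (A : set T) : nat := #|` fset_set A|.

Definition Pset (n m : nat) (u v : {ffun 'I_n -> nat}) :
    set (seq (nat * colour n)) :=
  [set l | [/\ is_Pn l, Pn_weight l = m, Pn_count_a l = u & Pn_count_b l = v]].

Definition Fset (n m : nat) (u v : {ffun 'I_n -> nat}) : set (frob n) :=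
  [set f | [/\ is_frob f, frob_weight f = m, frob_count_a f = u
             & frob_count_b f = v]].

Definition Pcount (n m : nat) (u v : {ffun 'I_n -> nat}) : nat :=
  ncard (Pset m u v).
Definition Fcount (n m : nat) (u v : {ffun 'I_n -> nat}) : nat :=
  ncard (Fset m u v).

Lemma finite_bounded_seq (n m : nat) :
  finite_set [set l : seq (nat * 'I_n) |
    ((size l <= m)%N && all (fun p => p.1 <= m)%N l)].
Proof.
pose g (t : m.-bseq ('I_m.+1 * 'I_n)) : seq (nat * 'I_n) :=
  [seq (nat_of_ord p.1, p.2) | p <- t].
apply: (@sub_finite_set _ _ (g @` [set: m.-bseq ('I_m.+1 * 'I_n)])); last first.
  by apply: finite_image; apply: finite_finset.
move=> l /= /andP[sl al].
pose l' : seq ('I_m.+1 * 'I_n) := [seq (inord p.1, p.2) | p <- l].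
have sl' : (size l' <= m)%N by rewrite size_map.
exists (Bseq sl') => //=; rewrite /g /= /l' -map_comp -[RHS]map_id.
apply/eq_in_map => -[p c] /(allP al) /= le_pm; by rewrite inordK.
Qed.

Lemma mem_leq_sum (T : eqType) (F : T -> nat) (s : seq T) x :
  x \in s -> (F x <= \sum_(y <- s) F y)%N.
Proof. by move=> xs; rewrite (big_rem x) //= leq_addr. Qed.

Lemma Plevel_finite (n m : nat) :
  finite_set [set l : seq (nat * colour n) | is_Pn l /\ Pn_weight l = m].
Proof.
pose A (i : 'I_2) (l : seq (nat * colour n)) : seq (nat * 'I_n) :=
  [seq (p.1, if i == ord0 then p.2.1 else p.2.2) | p <- l].
pose B := [set l : seq (nat * 'I_n) |
  ((size l <= m)%N && all (fun p => p.1 <= m)%N l)].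
have fB : finite_set (B `*` B) by apply: finite_setX; apply: finite_bounded_seq.
pose g (x : seq (nat * 'I_n) * seq (nat * 'I_n)) : seq (nat * colour n) :=
  [seq (y.1.1, (y.1.2, y.2.2)) | y <- zip x.1 x.2].
apply: (sub_finite_set _ (finite_image g fB)) => l /= [/andP[pos _] wl].
have sl : (size l <= m)%N.
  rewrite -wl -sum1_size /Pn_weight !big_seq; apply: leq_sum => p pl.
  exact: (allP pos).
have lm p : p \in l -> (p.1 <= m)%N.
  by move=> pl; rewrite -wl; apply: (@mem_leq_sum _ (fun y => y.1)).
have BA i : B (A i l).
  rewrite /B /= size_map sl /= all_map; apply/allP => p /lm //.
exists (A ord0 l, A ord_max l); first by split; apply: BA.
rewrite /g /= /A; elim: {pos wl sl lm BA} l => //= -[p [a b]] l IHl /=.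
by rewrite IHl.
Qed.

Lemma Flevel_finite (n m : nat) :
  finite_set [set f : frob n | is_frob f /\ frob_weight f = m].
Proof.
pose B := [set l : seq (nat * 'I_n) |
  ((size l <= m)%N && all (fun p => p.1 <= m)%N l)].
have fB : finite_set (B `*` B) by apply: finite_setX; apply: finite_bounded_seq.
apply: sub_finite_set fB => -[la mu] /= [/and3P[/= /eqP es _ _]].
rewrite /frob_weight /= => wl.
have le1 p : p \in la -> (p.1 <= m)%N.
  move=> /(@mem_leq_sum _ (fun y => y.1)) /leq_trans; apply.
  by rewrite -wl -addnA addnCA leq_addr.
have le2 p : p \in mu -> (p.1 <= m)%N.
  move=> /(@mem_leq_sum _ (fun y => y.1)) /leq_trans; apply.
  by rewrite -wl leq_addl.
have sm : (size la <= m)%N by rewrite -wl -addnA leq_addr.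
by split; rewrite /B /= -?es sm /=; apply/allP.
Qed.

Lemma Pset_finite (n m : nat) (u v : {ffun 'I_n -> nat}) :
  finite_set (Pset m u v).
Proof. by apply: sub_finite_set (@Plevel_finite n m) => l [? ? _ _]. Qed.

Lemma Fset_finite (n m : nat) (u v : {ffun 'I_n -> nat}) :
  finite_set (Fset m u v).
Proof. by apply: sub_finite_set (@Flevel_finite n m) => l [? ? _ _]. Qed.

Lemma ncard_neq0 (T : choiceType) (A : set T) : ncard A <> 0%N -> exists x, A x.
Proof.
by have [->|/set0P //] := eqVneq A set0; rewrite /ncard fset_set0 cardfs0.
Qed.

Definition mindex (n : nat) : Type :=
  (nat * {ffun 'I_n -> nat} * {ffun 'I_n -> nat})%type.

(* C(m; u; v) q^m prod_i a_i^(u_i - v_i) *)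
Definition gf_term (n : nat)
    (C : nat -> {ffun 'I_n -> nat} -> {ffun 'I_n -> nat} -> nat)
    (t : mindex n) : fps (laurent n) :=
  let: (m, u, v) := t in
  (C m u v)%:R * fpsX ^+ m
  * fpsC (\prod_(i < n) avar i ^ ((u i)%:Z - (v i)%:Z)).

Lemma fcoef_gf_term (n : nat)
    (C : nat -> {ffun 'I_n -> nat} -> {ffun 'I_n -> nat} -> nat)
    (m k : nat) (u v : {ffun 'I_n -> nat}) :
  fcoef (gf_term C (m, u, v)) k =
    (\prod_(i < n) avar i ^ ((u i)%:Z - (v i)%:Z)) *+ C m u v *+ (k == m).
Proof.
set c : laurent n := \prod_(i < n) _.
have -> : gf_term C (m, u, v) = (fpsC c *+ C m u v) * fpsX ^+ m.
  by rewrite /gf_term -/c mulrAC mulr_natl.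
have cMn (j d : nat) : fcoef (fpsC c *+ d) j = c *+ d *+ (j == 0)%N.
  elim: d => [|d IHd]; first by rewrite !mulr0n mul0rn.
  by rewrite !mulrS mulrnDl -IHd.
rewrite fcoefMX cMn; case: (ltngtP k m) => [lt_km|lt_mk|->] //.
  by rewrite subn_eq0 leqNgt lt_mk.
by rewrite subnn eqxx.
Qed.

Lemma gf_P_summable (n : nat) : fps_summable (gf_term (@Pcount n)).
Proof.
move=> k; pose st l : mindex n := (Pn_weight l, Pn_count_a l, Pn_count_b l).
apply: (sub_finite_set _ (finite_image st (@Plevel_finite n k))).
move=> [[m u] v] h; have {h} : fcoef (gf_term (@Pcount n) (m, u, v)) k <> 0 := h.
rewrite fcoef_gf_term.
case: eqVneq => [<-|]; last by rewrite mulr0n.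
have [->|/eqP /ncard_neq0[l [Pl wl ul vl]] _] := eqVneq (Pcount k u v) 0%N.
  by rewrite mulr0n mul0rn.
by exists l => //; rewrite /st wl ul vl.
Qed.

Lemma gf_F_summable (n : nat) : fps_summable (gf_term (@Fcount n)).
Proof.
move=> k; pose st f : mindex n := (frob_weight f, frob_count_a f, frob_count_b f).
apply: (sub_finite_set _ (finite_image st (@Flevel_finite n k))).
move=> [[m u] v] h; have {h} : fcoef (gf_term (@Fcount n) (m, u, v)) k <> 0 := h.
rewrite fcoef_gf_term.
case: eqVneq => [<-|]; last by rewrite mulr0n.
have [->|/eqP /ncard_neq0[f [Ff wf uf vf]] _] := eqVneq (Fcount k u v) 0%N.
  by rewrite mulr0n mul0rn.
by exists f => //; rewrite /st wf uf vf.
Qed.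

(* Main.v *)
Require Import Defs.
From mathcomp Require Import all_boot all_order all_algebra.
From mathcomp Require Import finmap monalg.
From mathcomp Require Import boolp classical_sets functions cardinality fsbigop.
From mathcomp Require Import ring zify.
Set Implicit Arguments.
Unset Strict Implicit.
Unset Printing Implicit Defensive.
Import Order.TTheory GRing.Theory Num.Theory.
Local Open Scope classical_set_scope.
Local Open Scope ring_scope.

(* Colour sequences of P_n carry the weight q^(sum of j Delta(c_j, c_(j+1))).
   Written as one word i_1 k_1 i_2 k_2 ..., the exponent is local in triples of
   consecutive letters, and each step of the resulting transfer recursion is a
   telescoping sum. This leads to a closed form for the generating function of
   the partitions in P_n with s parts that remain admissible when a part of
   size 0 and colour a_i b_k is appended:
     sum_t c(s,t) q^([i<k] (s-t)) phi_(i,t) psi_(k,t)   (i <> k),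
   where c(s,t) = (1-q^s)(1-q^(s-1))...(1-q^(s-t+1)) and phi_(i,t), psi_(k,t)
   enumerate single rows of t parts of Frobenius partitions with a condition on
   the last part. Summing over s <= N and over the colours gives
     sum_(s <= N) P_(n,s) = sum_(t <= N) q^t c(N,t) e_t(a) e_t(1/a),
   with e_t the generating function of all rows, so N -> oo yields the
   Frobenius series. The rows e_t are in turn the coefficients of x^t in
   prod_i (-x a_i; q)_oo, because both satisfy the recursion obtained from
   multiplying by one factor (1 + x a_i) at a time. *)

(** * The transfer recursion and its closed form *)

Section Falling.
Variables (R : comNzRingType) (q : R).

Definition qfall (s t : nat) : R := \prod_(j < t) (1 - q ^+ (s - j)).

Lemma qfall0 s : qfall s 0 = 1.
Proof. by rewrite /qfall big_ord0. Qed.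

Lemma qfallSr s t : qfall s t.+1 = qfall s t * (1 - q ^+ (s - t)).
Proof. by rewrite /qfall big_ord_recr. Qed.

Lemma qfallSS s t : qfall s.+1 t.+1 = (1 - q ^+ s.+1) * qfall s t.
Proof. by rewrite /qfall big_ord_recl subn0. Qed.

(** Truncated subtraction makes the factor at [j = s] equal to 1 - q^0 = 0; this kills the top terms
    when sums are shifted below. *)
Lemma qfall_gt s t : (s < t)%N -> qfall s t = 0.
Proof.
elim: t => // t IHt; rewrite ltnS leq_eqVlt qfallSr => /orP[/eqP <-|/IHt ->].
  by rewrite subnn expr0 subrr mulr0.
by rewrite mul0r.
Qed.

Lemma qfall_expr s t : q ^+ (s - t) * qfall s t = qfall s t - qfall s t.+1.
Proof. by rewrite qfallSr; ring. Qed.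

Lemma qfall_diff s t :
  q ^+ s.+1 * (qfall s t * (1 - q ^+ t.+1)) =
  q ^+ t.+1 * (qfall s.+1 t.+1 - qfall s t.+1).
Proof.
have [le_ts|lt_st] := leqP t s; last first.
  by rewrite !qfall_gt // 1?ltnW // mul0r subrr !mulr0.
have e : q ^+ s = q ^+ (s - t) * q ^+ t by rewrite -exprD subnK.
rewrite qfallSS qfallSr !exprS e.
by ring.
Qed.

End Falling.

(** The blocks below and above [j] telescope separately, the upper one with weight [x]; the transfer
    weights have this shape. *)
Lemma sum_weighted_telescope (R : comNzRingType) (x : R) (T : nat -> R) n j :
  (j <= n)%N ->
  \sum_(i < n) (if (j <= i)%N then x else 1) * (T i.+1 - T i) =
  x * (T n - T j) + (T j - T 0).
Proof.
elim: n => [|n IHn]; first by rewrite leqn0 big_ord0 => /eqP ->; ring.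
rewrite big_ord_recr /= leq_eqVlt => /orP[/eqP ->|]; last first.
  by rewrite ltnS => le_jn; rewrite IHn // le_jn; ring.
rewrite ltnn -[T n.+1 - T 0](subrKA (T n)) -(telescope_sumr _ (leq0n n)) big_mkord.
rewrite subrr mulr0 add0r mul1r addrC; congr (_ + _).
by apply: eq_bigr => i _; rewrite leqNgt ltnS (ltnW (ltn_ord i)) mul1r.
Qed.

(** * Uniqueness of solutions of the row recursion *)

Section RowSystems.
Variables (R : comNzRingType) (q : R) (n : nat).
Hypothesis q_reg : forall t, GRing.lreg (1 - q ^+ t.+1).

(* f i t is the coefficient of x^t in prod_(l < i) (1 + x a_l) F(x q), where
   F(x) = prod_l (1 + x a_l) F(x q) and F(0) = 1. *)
Definition row_system (a : 'I_n -> R) (f : nat -> nat -> R) : Prop :=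
  [/\ forall i, f i 0 = 1,
      forall (i : 'I_n) t, f i.+1 t.+1 = f i t.+1 + a i * f i t
    & forall t, f 0 t = q ^+ t * f n t].

Lemma row_systemE a f (i : nat) t : row_system a f -> (i <= n)%N ->
  f i t.+1 = f 0 t.+1 + \sum_(l < n | (l < i)%N) a l * f l t.
Proof.
case=> _ fS _; elim: i => [|i IHi] lt_in; first by rewrite big_pred0 ?addr0.
rewrite (fS (Ordinal lt_in)) IHi 1?ltnW //= [in RHS](bigD1 (Ordinal lt_in)) //= -addrA.
congr (_ + _); rewrite addrC; congr (_ + _); apply: eq_bigl => l.
by rewrite ltnS [in RHS]leq_eqVlt -val_eqE /=; case: ltngtP.
Qed.

(** By [row_systemE], level t determines f_n - f_0 at level t+1. Together with f_0 = q^(t+1) f_n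
    this fixes (1 - q^(t+1)) f_0, and the factor cancels by [q_reg]. *)
Lemma row_system_unique a f g (i : nat) t :
  row_system a f -> row_system a g -> (i <= n)%N -> f i t = g i t.
Proof.
move=> sf sg; have [f0 _ fq] := sf; have [g0 _ gq] := sg.
elim: t i => [|t IHt] i le_in; first by rewrite f0 g0.
have sumE j : \sum_(l < n | (l < j)%N) a l * f l t =
              \sum_(l < n | (l < j)%N) a l * g l t.
  by apply: eq_bigr => l _; rewrite IHt // ltnW.
suff e0 : f 0 t.+1 = g 0 t.+1.
  by rewrite (row_systemE _ sf) // (row_systemE _ sg) // e0 sumE.
have /= := row_systemE t sf (leqnn n); rewrite sumE => fn.
have /= gn := row_systemE t sg (leqnn n).
apply: (@q_reg t); rewrite !mulrBl !mul1r.
have -> : q ^+ t.+1 * f 0 t.+1 = f 0 t.+1 - q ^+ t.+1 * (f n t.+1 - f 0 t.+1).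
  by rewrite mulrBr -fq; ring.
have -> : q ^+ t.+1 * g 0 t.+1 = g 0 t.+1 - q ^+ t.+1 * (g n t.+1 - g 0 t.+1).
  by rewrite mulrBr -gq; ring.
by rewrite fn gn; ring.
Qed.

End RowSystems.

(** * Double telescoping for the closed form *)

Section ClosedForm.
Variables (R : comNzRingType) (q : R) (n : nat).
Variables (a b : 'I_n -> R).
Hypothesis ab1 : forall i, a i * b i = 1.
Variables (phi psi : nat -> nat -> R).
Hypothesis phi0 : forall i, phi i 0 = 1.
Hypothesis phiS : forall (i : 'I_n) t, phi i.+1 t.+1 = phi i t.+1 + a i * phi i t.
Hypothesis phiq : forall t, phi 0 t = q ^+ t * phi n t.
Hypothesis psi0 : forall k, psi k 0 = 1.
Hypothesis psiS : forall (k : 'I_n) t,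
  psi k t.+1 = psi k.+1 t.+1 + b k * psi k.+1 t.
Hypothesis psiq : forall t, psi n t = q ^+ t * psi 0 t.

(* The closed form is, up to the shift of k in the case i = k, [tele_b]; summing
   it over i (resp. summing the result over k) against the transfer weights
   telescopes, with primitive [tele_a] (resp. [tele_b]). The index of psi is
   one more than in the header above, so that it runs over 0..n like that of phi. *)
Definition tele_b (s i k : nat) : R :=
  \sum_(t < s.+1) qfall q s t * (if (i < k)%N then q ^+ (s - t) else 1)
                  * phi i t * psi k t.

Definition tele_a (s i : nat) (k : 'I_n) : R :=
  b k * \sum_(t < s.+1) qfall q s t * (if (i <= k)%N then q ^+ (s - t) else 1)
                  * phi i t.+1 * psi k.+1 t.

Definition closed_form (s : nat) (i k : 'I_n) : R :=
  tele_b s i (if i == k then nat_of_ord k else k.+1).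

Lemma closed_form0 i k : closed_form 0 i k = 1.
Proof.
by rewrite /closed_form /tele_b big_ord1 qfall0 subnn expr0 phi0 psi0 if_same !mulr1.
Qed.

(** Off the diagonal both ends carry the same weight and [phiS] suffices. For i = k the weight
    q^(s-t) at [i] becomes 1 at [i.+1]; [qfall_expr] turns this jump into a shift of [t], absorbed
    by [psiS] and a_k b_k = 1. *)
Lemma closed_form_tele_a s (i k : 'I_n) :
  a i * b k * closed_form s i k = tele_a s i.+1 k - tele_a s i k.
Proof.
rewrite /closed_form /tele_a -mulrBr; have [->|ne_ik] := eqVneq i k; last first.
  rewrite -sumrB mulrAC mulrC; congr (_ * _).
  rewrite mulr_sumr; apply: eq_bigr => t _; rewrite phiS ltnS.
  have -> : (i < k)%N = (i <= k)%N by rewrite [RHS]leq_eqVlt val_eqE (negPf ne_ik).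
  by ring.
rewrite ab1 mul1r /tele_b !ltnn leqnn.
under [X in _ - X]eq_bigr => t _ do rewrite [qfall q s t * _]mulrC qfall_expr.
rewrite -sumrB [in RHS](eq_bigr (fun t : 'I_s.+1 =>
  a k * (qfall q s t * phi k t * psi k.+1 t) +
  qfall q s t.+1 * phi k t.+1 * psi k.+1 t)) => [|t _]; last first.
  by rewrite phiS; ring.
rewrite big_split /= mulrDr -mulr_sumr mulrA [b k * a k]mulrC ab1 mul1r.
rewrite big_ord_recl [X in _ = X + _]big_ord_recl [X in _ + _ * X]big_ord_recr /=.
rewrite (@qfall_gt _ _ s s.+1) // !mul0r addr0 !psi0 -addrA; congr (_ + _); first by ring.
rewrite mulr_sumr -big_split /=; apply: eq_bigr => t _.
by rewrite /bump /= add1n psiS; ring.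
Qed.

(** [qfallSS] absorbs 1 - q^(s+1). The shift to [i.+1] on the diagonal comes from the extra diagonal
    weight in the transfer recursion; that case again uses [qfall_expr] and a_k b_k = 1. *)
Lemma tele_a_tele_b s (i k : 'I_n) :
  (1 - q ^+ s.+1) * tele_a s (if i == k then i.+1 else i) k =
  tele_b s.+1 i k - tele_b s.+1 i k.+1.
Proof.
rewrite /tele_a mulrCA mulr_sumr.
under eq_bigr => t _ do rewrite !mulrA -qfallSS.
rewrite /tele_b -sumrB [in RHS]big_ord_recl /= !qfall0 !phi0 !psi0.
have [->|ne_ik] := eqVneq i k; last first.
  have e : ((i < k)%N = (i <= k)%N) by rewrite [RHS]leq_eqVlt val_eqE (negPf ne_ik).
  rewrite ltnS e subrr add0r mulr_sumr; apply: eq_bigr => t _.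
  by rewrite /bump /= add1n subSS psiS; ring.
rewrite ltnn ltnSn /= subn0.
rewrite [in RHS](eq_bigr (fun t : 'I_s.+1 =>
  b k * (qfall q s.+1 t.+1 * phi k t.+1 * psi k.+1 t) +
  qfall q s.+1 t.+2 * phi k t.+1 * psi k.+1 t.+1)) => [|t _]; last first.
  rewrite /bump /= add1n [qfall q s.+1 t.+1 * q ^+ _]mulrC qfall_expr psiS.
  by ring.
rewrite [in LHS](eq_bigr (fun t : 'I_s.+1 =>
  qfall q s.+1 t.+1 * phi k t.+1 * psi k.+1 t +
  a k * (qfall q s.+1 t.+1 * phi k t * psi k.+1 t))) => [|t _]; last first.
  by rewrite phiS; ring.
rewrite !big_split /= -!mulr_sumr mulrDr mulrA [b k * a k]mulrC ab1 mul1r.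
rewrite addrCA; congr (_ + _).
rewrite big_ord_recl [X in _ = _ + X]big_ord_recr /=.
rewrite (@qfall_gt _ _ s.+1 s.+2) // !mul0r addr0.
rewrite phi0 psi0 qfallSS qfall0 !mulr1 !mul1r; by congr (_ + _).
Qed.

(** With x = q^(s+1) and x T n = T 0, the weighted telescope x (T n - T j) + (T j - T 0) collapses
    to (1 - x) T j. [tele_b_q] plays this part for the sum over [k]. *)
Lemma tele_a_q s k : q ^+ s.+1 * tele_a s n k = tele_a s 0 k.
Proof.
rewrite /tele_a mulrCA mulr_sumr leqNgt ltn_ord leq0n /=; congr (_ * _).
apply: eq_bigr => t _; rewrite phiq.
have e : q ^+ s = q ^+ (s - t) * q ^+ t.
  by rewrite -exprD subnK // -ltnS.
by rewrite !exprS e; ring.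
Qed.

Lemma tele_b_q s (i : 'I_n) : q ^+ s * tele_b s i 0 = tele_b s i n.
Proof.
rewrite /tele_b mulr_sumr ltn_ord ltn0; apply: eq_bigr => t _; rewrite psiq.
have e : q ^+ s = q ^+ (s - t) * q ^+ t by rewrite -exprD subnK // -ltnS.
by rewrite e; ring.
Qed.
(** The two bracketed weights are the two halves of q^((s+1) Delta). The sum over [i] has primitive
    [tele_a] and yields an increment of [tele_b], so the sum over [k] telescopes too; the diagonal
    weights supply the index shift in [closed_form]. *)
Lemma closed_form_rec s (i' k' : 'I_n) (e := 1 - q ^+ s.+1) :
  e * closed_form s.+1 i' k' =
  \sum_(k < n) ((if (k <= k')%N then q ^+ s.+1 else 1) +
          (if (k == i') && (i' == k') then e else 0)) *
   \sum_(i < n) a i * b k * ((if (i' <= i)%N then q ^+ s.+1 else 1) +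
          (if (i == k) && (k == i') then e else 0)) * closed_form s i k.
Proof.
have sum1 (k : 'I_n) : \sum_(i < n) a i * b k * ((if (i' <= i)%N then q ^+ s.+1 else 1) +
          (if (i == k) && (k == i') then e else 0)) * closed_form s i k
   = tele_b s.+1 i' k - tele_b s.+1 i' k.+1.
  rewrite -tele_a_tele_b -/e.
  under eq_bigr => i _ do rewrite mulrAC closed_form_tele_a mulrDr mulrC.
  rewrite big_split /= (@sum_weighted_telescope _ _ (tele_a s ^~ k)) 1?ltnW //.
  rewrite (bigD1 k) //= [X in _ + (_ + X)]big1 ?addr0 => [|i /negPf ->]; last first.
    by rewrite mulr0.
  rewrite eqxx /= mulrBr tele_a_q [k == i']eq_sym.
  by case: eqVneq => [->|_]; rewrite /e; ring.
under eq_bigr => k _ do rewrite sum1 mulrDl.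
rewrite big_split /=.
have -> : \sum_(k < n) (if (k <= k')%N then q ^+ s.+1 else 1) *
  (tele_b s.+1 i' k - tele_b s.+1 i' k.+1) = e * tele_b s.+1 i' k'.+1.
  (* The weight sits on the lower block [k <= k'], so the order of summation is reversed. *)
  have := @sum_weighted_telescope _ (q ^+ s.+1)
    (fun k => - tele_b s.+1 i' (n - k)) n (n - k'.+1) (leq_subr _ _).
  rewrite subnn subn0 subKn // (reindex_inj rev_ord_inj) /=.
  rewrite -tele_b_q => e0.
  transitivity (q ^+ s.+1 * (tele_b s.+1 i' 0 - tele_b s.+1 i' k'.+1) +
    (tele_b s.+1 i' k'.+1 - q ^+ s.+1 * tele_b s.+1 i' 0)); last by rewrite /e; ring.
  rewrite -[LHS]opprK -[RHS]opprK; congr (- _).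
  transitivity (q ^+ s.+1 * (- tele_b s.+1 i' 0 - - tele_b s.+1 i' k'.+1) +
     (- tele_b s.+1 i' k'.+1 - - (q ^+ s.+1 * tele_b s.+1 i' 0))); last by ring.
  rewrite -e0 -sumrN; apply: eq_bigr => k _.
  have lt_kn := ltn_ord k.
  have -> : (n - (n - k.+1).+1 = k)%N by lia.
  have -> : (n - (n - k.+1) = k.+1)%N by lia.
  have -> : (n - k'.+1 <= n - k.+1)%N = (k <= k')%N by have := ltn_ord k'; lia.
  by ring.
rewrite (bigD1 i') //= [X in _ + (_ + X)]big1 ?addr0 => [|k /negPf ->]; last first.
  by rewrite mul0r.
rewrite eqxx /= /closed_form; case: eqVneq => [->|_]; ring.
Qed.

(** No weight depends on the colours here: both sums are plain telescopes, closed by [tele_a_q] and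
    [psiq]. *)
Lemma closed_form_total s :
  \sum_k \sum_i a i * b k * closed_form s i k =
  (1 - q ^+ s.+1) * \sum_(t < s.+1) qfall q s t * (1 - q ^+ t.+1)
     * phi n t.+1 * psi 0 t.+1.
Proof.
have sum1 (k : 'I_n) :
    \sum_i a i * b k * closed_form s i k = (1 - q ^+ s.+1) * tele_a s n k.
  under eq_bigr => i _ do rewrite closed_form_tele_a.
  rewrite -(big_mkord xpredT (fun i => tele_a s i.+1 k - tele_a s i k)) telescope_sumr //.
  by rewrite -tele_a_q; ring.
under eq_bigr => k _ do rewrite sum1.
rewrite -mulr_sumr; congr (_ * _).
under eq_bigr => k _ do rewrite /tele_a leqNgt ltn_ord /= mulr_sumr.
rewrite exchange_big /=; apply: eq_bigr => t _.
transitivity (qfall q s t * phi n t.+1 * \sum_(k < n) (psi k t.+1 - psi k.+1 t.+1)).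
  by rewrite mulr_sumr; apply: eq_bigr => k _; rewrite psiS; ring.
have -> : \sum_(k < n) (psi k t.+1 - psi k.+1 t.+1) = psi 0 t.+1 - psi n t.+1.
  rewrite -(big_mkord xpredT (fun k => psi k t.+1 - psi k.+1 t.+1)).
  rewrite (@telescope_sumr_eq _ _ _ (fun k => - psi k t.+1)) // => [|k _]; ring.
by rewrite psiq; ring.
Qed.

End ClosedForm.

(** By [qfall_diff], [Y N.+1] is the increment of the right-hand side in [N]. It is applied with
    [Y s] enumerating partitions with s parts and [F t] pairs of rows of length t. *)
Lemma sum_falling (R : comNzRingType) (q : R) (F Y : nat -> R) (N : nat) :
  Y 0 = F 0 ->
  (forall s, Y s.+1 = q ^+ s.+1 *
     \sum_(t < s.+1) qfall q s t * (1 - q ^+ t.+1) * F t.+1) ->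
  \sum_(s < N.+1) Y s = \sum_(t < N.+1) q ^+ t * qfall q N t * F t.
Proof.
move=> Y0 YS; elim: N => [|N IHN].
  by rewrite !big_ord1 expr0 qfall0 Y0 !mul1r.
rewrite big_ord_recr IHN YS [RHS]big_ord_recl [X in X + _ = _]big_ord_recl /=.
rewrite !qfall0 -addrA.
congr (_ + _); rewrite mulr_sumr.
have -> : \sum_(t < N) q ^+ bump 0 t * qfall q N (bump 0 t) * F (bump 0 t) =
  \sum_(t < N.+1) q ^+ t.+1 * qfall q N t.+1 * F t.+1.
  by rewrite big_ord_recr /= (@qfall_gt _ _ N N.+1) // mulr0 mul0r addr0.
rewrite -big_split /=; apply: eq_bigr => t _.
by rewrite mulrA qfall_diff /bump /= add1n; ring.
Qed.

Lemma sum_geometric_from (R : comNzRingType) (x : R) a N : (a <= N)%N ->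
  (1 - x) * \sum_(d < N | (a <= d)%N) x ^+ d = x ^+ a - x ^+ N.
Proof.
elim: N => [|N IHN]; first by rewrite leqn0 big_ord0 => /eqP ->; ring.
rewrite big_mkcond big_ord_recr -big_mkcond /= leq_eqVlt => /orP[/eqP ->|].
  rewrite ltnn big_pred0 => [|d]; first by ring.
  by rewrite leqNgt (leq_trans (ltn_ord d)).
by rewrite ltnS => le_aN; rewrite le_aN mulrDr IHN // exprS; ring.
Qed.

(** * Coefficients of power series and reindexing of finite sums *)

Section FpsCoefficients.
Variable R : comNzRingType.
Implicit Types (f g : fps R) (c : R).

Lemma fcoefD f g m : fcoef (f + g) m = fcoef f m + fcoef g m.
Proof. by []. Qed.

Lemma fcoefB f g m : fcoef (f - g) m = fcoef f m - fcoef g m.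
Proof. by []. Qed.

Lemma fcoef_sum (I : Type) (r : seq I) (P : pred I) (F : I -> fps R) m :
  fcoef (\sum_(i <- r | P i) F i) m = \sum_(i <- r | P i) fcoef (F i) m.
Proof. by elim/big_rec2: _ => // i x y _ <-; rewrite fcoefD. Qed.

Lemma fcoefM f g m :
  fcoef (f * g) m = \sum_(i < m.+1) fcoef f i * fcoef g (m - i).
Proof. by []. Qed.

Lemma fcoefCM c f m : fcoef (fpsC c * f) m = c * fcoef f m.
Proof.
rewrite fcoefM big_ord_recl subn0 /= big1 ?addr0 // => i _.
by rewrite mulr0n mul0r.
Qed.

Lemma fpsCM c d : fpsC (c * d) = fpsC c * fpsC d.
Proof.
by apply: fpsP => m; rewrite fcoefCM /=; case: m => [|m]; rewrite ?mulr0n ?mulr0.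
Qed.

Lemma fcoefXnM f j m : fcoef (fpsX ^+ j * f) m =
  if (m < j)%N then 0 else fcoef f (m - j)%N.
Proof. by rewrite mulrC fcoefMX. Qed.

Lemma fcoefM_eqr f g h m : (forall j, (j <= m)%N -> fcoef g j = fcoef h j) ->
  fcoef (f * g) m = fcoef (f * h) m.
Proof. by move=> e; rewrite !fcoefM; apply: eq_bigr => i _; rewrite e ?leq_subr. Qed.

(** Coefficient m of (1 - q^(t+1)) f is that of f minus an earlier one, so f is recovered
    inductively. Cancelling this factor replaces division. *)
Lemma lreg_1subXn t : GRing.lreg (1 - fpsX ^+ t.+1 : fps R).
Proof.
move=> f g efg; apply: fpsP => m; elim/ltn_ind: m => m IHm.
have := congr1 (fun h => fcoef h m) efg.
rewrite !mulrBl !mul1r !fcoefB !fcoefXnM; case: ltnP => [_|lt_tm].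
  by rewrite !subr0.
by rewrite (IHm (m - t.+1)%N) ?ltn_subrL ?(leq_ltn_trans (leq0n t) lt_tm) // => /addIr.
Qed.

End FpsCoefficients.

Lemma sum_fset_set_uniq (T : choiceType) (V : nmodType) (A : set T) (P : pred T)
    (r : seq T) (F : T -> V) :
  finite_set A -> uniq r -> (forall x, x \in r <-> A x /\ P x) ->
  \sum_(x <- fset_set A | P x) F x = \sum_(x <- r) F x.
Proof.
move=> fA ur rA; rewrite -big_filter; apply: perm_big; apply: uniq_perm => //.
  by rewrite filter_uniq // fset_uniq.
move=> x; rewrite mem_filter in_fset_set //; apply/andP/idP.
  by move=> [Px]; rewrite inE => Ax; apply/rA.
by move/rA => [Ax Px]; rewrite inE.
Qed.

Lemma sum_fset_set_bij (T U : choiceType) (V : nmodType) (A : set T) (B : set U)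
    (P : pred T) (g : U -> T) (F : T -> V) :
  finite_set A -> finite_set B ->
  (forall y y', B y -> B y' -> g y = g y' -> y = y') ->
  (forall x, A x /\ P x <-> exists2 y, B y & g y = x) ->
  \sum_(x <- fset_set A | P x) F x = \sum_(y <- fset_set B) F (g y).
Proof.
move=> fA fB ginj AB; rewrite -(big_map g xpredT).
apply: sum_fset_set_uniq => // [|x].
  rewrite map_inj_in_uniq ?fset_uniq // => y y'.
  by rewrite !in_fset_set // !inE; apply: ginj.
split=> [/mapP[y]|/AB[y By <-]].
  by rewrite in_fset_set // inE => By ->; apply/AB; exists y.
by apply: map_f; rewrite in_fset_set // inE.
Qed.

(** * Generating functions of coloured partitions with gap conditions *)

Section ColouredLists.
Variables (C : finType) (K : comNzRingType) (D : C -> C -> nat) (w : C -> K).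
Local Notation T := (seq (nat * C)).
Implicit Types (l : T) (p : nat * C) (theta : C -> nat).

Definition gap_rel p p' : bool := (D p.2 p'.2 + p'.1 <= p.1)%N.

(** The bound may depend on the colour: [D^~ c] says that a part of size 0 and colour [c] can be
    appended, the constant 1 that the last part is positive; 0 imposes nothing. *)
Definition last_ge theta l : bool :=
  if l is p :: l' then (theta (last p l').2 <= (last p l').1)%N else true.

Definition list_weight l : nat := \sum_(p <- l) p.1.
Definition list_val l : K := \prod_(p <- l) w p.2.

Definition gap_lists s theta m : set T :=
  [set l | [/\ size l = s, sorted gap_rel l, last_ge theta l & list_weight l = m]].

Definition gap_gf s theta : fps K :=
  Fps (fun m => \sum_(l <- fset_set (gap_lists s theta m)) list_val l).

Lemma gap_lists_finite s theta m : finite_set (gap_lists s theta m).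
Proof.
pose g (t : s.-tuple ('I_m.+1 * C)) : T := [seq (nat_of_ord y.1, y.2) | y <- t].
apply: (@sub_finite_set _ _ (g @` [set: s.-tuple ('I_m.+1 * C)])); last first.
  by apply: finite_image; apply: finite_finset.
move=> l /= [sl _ _ wl].
pose l' : seq ('I_m.+1 * C) := [seq (inord p.1, p.2) | p <- l].
have sl' : size l' == s by rewrite size_map sl.
exists (Tuple sl') => //=; rewrite /g /= /l' -map_comp -[RHS]map_id.
apply/eq_in_map => -[p c] pl /=; rewrite inordK // ltnS -wl.
exact: (@mem_leq_sum _ (fun y => y.1) _ _ pl).
Qed.

Definition shift d l : T := [seq ((d + p.1)%N, p.2) | p <- l].

Lemma shift_inj d : injective (shift d).
Proof. by apply: inj_map => -[x c] [y c'] [/addnI -> ->]. Qed.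

Lemma sorted_shift d l : sorted gap_rel (shift d l) = sorted gap_rel l.
Proof.
rewrite /shift sorted_map; apply: eq_sorted => p p'.
by rewrite /gap_rel /= addnCA leq_add2l.
Qed.

Lemma list_weight_shift d l :
  list_weight (shift d l) = (size l * d + list_weight l)%N.
Proof.
rewrite /list_weight big_map big_split /=.
by rewrite big_const_seq count_predT iter_addn_0 mulnC.
Qed.

Lemma list_val_shift d l : list_val (shift d l) = list_val l.
Proof. by rewrite /list_val big_map. Qed.

Lemma list_weight_rcons l p : list_weight (rcons l p) = (list_weight l + p.1)%N.
Proof. by rewrite /list_weight -cats1 big_cat big_seq1. Qed.

Lemma list_val_rcons l p : list_val (rcons l p) = list_val l * w p.2.
Proof. by rewrite /list_val -cats1 big_cat big_seq1. Qed.

Lemma last_ge_rcons theta l p : last_ge theta (rcons l p) = (theta p.2 <= p.1)%N.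
Proof. by case: l => //= p' l; rewrite last_rcons. Qed.

(** Gap conditions only see differences: subtracting [d] everywhere makes the last part 0, and its
    gap condition becomes a bound on the part before it. *)
Lemma sorted_rcons_shift d c l :
  sorted gap_rel (rcons (shift d l) (d, c)) =
  sorted gap_rel l && last_ge (D^~ c) l.
Proof.
have -> : rcons (shift d l) (d, c) = shift d (rcons l (0%N, c)).
  by rewrite /shift map_rcons /= addn0.
rewrite sorted_shift; case: l => //= p l.
by rewrite rcons_path /gap_rel /= addn0.
Qed.

Lemma sorted_rcons_ge l p p' :
  sorted gap_rel (rcons l p) -> p' \in l -> (p.1 <= p'.1)%N.
Proof.
move=> sl p'l; have : sorted (fun x y : nat * C => (y.1 <= x.1)%N) (rcons l p).
  by apply: sub_sorted sl => x y; apply: leq_trans; apply: leq_addl.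
rewrite sorted_pairwise => [|y x z /= yx zy]; last exact: leq_trans zy yx.
rewrite -cats1 pairwise_cat => /and3P[/allrelP/(_ p' p p'l) ge_pp' _ _].
by apply: ge_pp'; rewrite inE.
Qed.

Lemma gap_gf0 theta : gap_gf 0 theta = 1.
Proof.
apply: fpsP => m /=; rewrite -[RHS]/(1 *+ (m == 0)).
have -> : fset_set (gap_lists 0 theta m) = (if m == 0 then [fset [::]] else fset0)%fset.
  apply/fsetP => l; rewrite in_fset_set; last exact: gap_lists_finite.
  apply/idP/idP.
    rewrite inE => -[/size0nil -> _ _].
    by rewrite /list_weight big_nil => <-; rewrite inE.
  case: eqP => // -> /fset1P ->; rewrite inE; split=> //.
  by rewrite /list_weight big_nil.
by case: eqP => _; rewrite ?big_seq_fset0 // big_seq_fset1 /list_val big_nil.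
Qed.

(* The last part (d, c) is removed and d is subtracted from all other parts. *)
Lemma gap_gfS_coef s theta m :
  fcoef (gap_gf s.+1 theta) m =
  \sum_c \sum_(d < m.+1 | (theta c <= d)%N && (s.+1 * d <= m)%N)
     w c * fcoef (gap_gf s (D^~ c)) (m - s.+1 * d).
Proof.
have [c0 _|C0] := pickP {: C}; last first.
  rewrite [RHS]big_pred0 //= (_ : gap_lists _ _ _ = set0) ?fset_set0 ?big_seq_fset0 //.
  by apply/seteqP; split=> // -[|[d c] l] [] //; have := C0 c.
(* [h] reads off the last part; the default [(0, c0)] is never reached in length s + 1, and [inord]
   is faithful as d <= m. *)
pose h l : C * 'I_m.+1 := ((last (0%N, c0) l).2, inord (last (0%N, c0) l).1).
have lastE l : l \in fset_set (gap_lists s.+1 theta m) -> exists l0 d c,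
    [/\ (d <= m)%N, (s.+1 * d <= m)%N, (theta c <= d)%N, l = rcons (shift d l0) (d, c)
      & gap_lists s (D^~ c) (m - s.+1 * d) l0].
  rewrite in_fset_set; last exact: gap_lists_finite.
  rewrite inE => -[]; case/lastP: l => // l [d c].
  rewrite size_rcons => -[sl] srt; rewrite last_ge_rcons /= => le_d wl.
  pose l0 := [seq ((p.1 - d)%N, p.2) | p <- l].
  have l0E : l = shift d l0.
    rewrite /shift -map_comp -[LHS]map_id; apply/eq_in_map => -[x c'] /=.
    move/(sorted_rcons_ge srt).
    by move=> /= le_dx; rewrite subnKC.
  have sl0 : size l0 = s by rewrite size_map.
  have wl0 : (s.+1 * d + list_weight l0 = m)%N.
    by rewrite -wl list_weight_rcons l0E list_weight_shift sl0 /= mulSn; lia.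
  move: srt; rewrite l0E sorted_rcons_shift => /andP[srt0 lg0].
  exists l0, d, c; split=> //.
  - by rewrite -wl0; apply: leq_trans (leq_addr _ _); rewrite leq_pmull.
  - by rewrite -wl0 leq_addr.
  by split=> //; rewrite -wl0 addKn.
rewrite pair_big_dep /= big_seq (partition_big h
  (fun x => (theta x.1 <= x.2)%N && (s.+1 * x.2 <= m)%N)) //=; last first.
  move=> l /lastE[l0 [d [c [dm sdm cd -> _]]]].
  by rewrite /h last_rcons /= inordK // cd.
apply: eq_bigr => -[c d] /= /andP[le_cd le_dm].
rewrite -big_seq_cond mulr_sumr.
rewrite (@sum_fset_set_bij _ _ _ _ (gap_lists s (D^~ c) (m - s.+1 * d)) _
   (fun l => rcons (shift d l) (nat_of_ord d, c))); first last.
- move=> l; split=> [[Al /eqP hl]|[l0 [sl0 srt0 lg0 wl0] <-]].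
    have /lastE[l0 [d' [c' [dm' _ _ lE Al0]]]] : l \in fset_set (gap_lists s.+1 theta m).
      by rewrite in_fset_set ?inE //; apply: gap_lists_finite.
    move: hl; rewrite lE /h last_rcons /= => -[ec /(congr1 val)].
    rewrite /= inordK // => ed.
    by exists l0; rewrite -?ed -?ec.
  split; last by rewrite /h last_rcons /= inord_val.
  split; rewrite ?size_rcons ?size_map ?sl0 ?last_ge_rcons ?sorted_rcons_shift ?srt0 //.
  rewrite list_weight_rcons list_weight_shift sl0 wl0 /= addnAC -mulSnr subnKC //.
- by move=> l l' _ _ /rcons_inj[/shift_inj].
- exact: gap_lists_finite.
- exact: gap_lists_finite.
by apply: eq_bigr => l _; rewrite list_val_rcons list_val_shift mulrC.
Qed.

(** The last part ranges over d >= theta c, a geometric series in q^(s+1) whose denominator is moved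
    to the left. *)
Lemma gap_gfS s theta :
  (1 - fpsX ^+ s.+1) * gap_gf s.+1 theta =
  \sum_c fpsC (w c) * (fpsX ^+ (s.+1 * theta c) * gap_gf s (D^~ c)).
Proof.
apply: fpsP => m.
(* For the coefficient of q^m the series can be cut at d <= m; the remainder q^((s+1)(m+1)) has
   order above m. *)
pose S c : fps K := \sum_(d < m.+1 | (theta c <= d)%N) fpsX ^+ (s.+1 * d).
pose g := \sum_c fpsC (w c) * (S c * gap_gf s (D^~ c)).
rewrite (@fcoefM_eqr _ _ _ g) => [|j le_jm]; last first.
  rewrite gap_gfS_coef fcoef_sum; apply: eq_bigr => c _.
  rewrite fcoefCM mulr_suml fcoef_sum -mulr_sumr; congr (_ * _).
  move: (gap_gf s (D^~ c)) => G.
  rewrite (big_ord_widen_cond m.+1 (fun d => (theta c <= d)%N && (s.+1 * d <= j)%N)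
     (fun d => fcoef G (j - s.+1 * d))) ?ltnS //.
  rewrite big_mkcond [RHS]big_mkcond; apply: eq_bigr => d _.
  rewrite fcoefXnM [(j < _)%N]ltnNge; case: (theta c <= d)%N => //=.
  have [le_dj|//] := leqP (s.+1 * d) j; rewrite /=.
  by rewrite ltnS (leq_trans _ le_dj) // leq_pmull.
rewrite mulr_sumr !fcoef_sum; apply: eq_bigr => c _.
rewrite mulrCA !fcoefCM; congr (_ * _); rewrite mulrA.
have [lt_mc|le_cm] := ltnP m (theta c).
  rewrite /S big_pred0 ?mulr0 ?mul0r => [|d].
    by rewrite fcoefXnM (leq_trans lt_mc) // leq_pmull.
  by apply/negbTE; rewrite -ltnNge (leq_trans (ltn_ord d)).
have -> : (1 - fpsX ^+ s.+1) * S c = fpsX ^+ (s.+1 * theta c) - fpsX ^+ (s.+1 * m.+1).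
  rewrite /S; under eq_bigr => d _ do rewrite exprM.
  by rewrite sum_geometric_from 1?ltnW // -!exprM.
rewrite mulrBl fcoefB [X in _ - X]fcoefXnM (leq_trans (ltnSn m)) ?subr0 //.
by rewrite leq_pmull.
Qed.

End ColouredLists.

(** * Rows of Frobenius partitions *)

Section RowGF.
Variables (n : nat) (K : comNzRingType) (w : 'I_n -> K).

(* gt_a and gt_b ask for these gaps between consecutive parts. *)
Definition gap_a (i i' : 'I_n) : nat := (i' <= i)%N.
Definition gap_b (k k' : 'I_n) : nat := (k <= k')%N.

(** A last part 0 must have colour below [i]: [row_a n] enumerates all rows, [row_a 0] those with
    positive parts. The bound is [gap_a^~ i], as left by removing a last part of colour [i]. For
    [row_b] the order is reversed, and colour [k] leaves [row_b k.+1]. *)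
Definition row_a (i t : nat) : fps K := gap_gf gap_a w t (fun l => (i <= l)%N : nat).
Definition row_b (k t : nat) : fps K := gap_gf gap_b w t (fun l => (l < k)%N : nat).

Lemma row_a0 i : row_a i 0 = 1.
Proof. exact: gap_gf0. Qed.

Lemma row_b0 k : row_b k 0 = 1.
Proof. exact: gap_gf0. Qed.

(** The expansions by the last part differ only at colour [i], where the bound is 0 instead of 1. *)
Lemma row_aS (i : 'I_n) t :
  row_a i.+1 t.+1 = row_a i t.+1 + fpsC (w i) * row_a i t.
Proof.
apply: (@lreg_1subXn _ t); rewrite mulrDr !gap_gfS.
rewrite (bigD1 i) //= [X in _ = X + _](bigD1 i) //= ltnn leqnn muln0 muln1 expr0.
rewrite -/(row_a i t) mul1r [X in _ + X = _](eq_bigr (fun c : 'I_n => fpsC (w c) *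
  (fpsX ^+ (t.+1 * (i <= c)%N) * row_a c t))) => [|c ne_ci]; first by ring.
by rewrite ltn_neqAle eq_sym val_eqE ne_ci.
Qed.

Lemma row_bS (k : 'I_n) t :
  row_b k t.+1 = row_b k.+1 t.+1 + fpsC (w k) * row_b k.+1 t.
Proof.
apply: (@lreg_1subXn _ t); rewrite mulrDr !gap_gfS.
rewrite (bigD1 k) //= [X in _ = X + _](bigD1 k) //= ltnn ltnSn muln0 muln1 expr0.
rewrite -/(row_b k.+1 t) mul1r [X in _ + X = _](eq_bigr (fun c : 'I_n => fpsC (w c) *
  (fpsX ^+ (t.+1 * (c < k.+1)%N) * row_b c.+1 t))) => [|c ne_ck]; first by ring.
by rewrite ltnS [(c <= k)%N]leq_eqVlt val_eqE (negPf ne_ck).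
Qed.

Lemma row_a_scale t : row_a 0 t = fpsX ^+ t * row_a n t.
Proof.
case: t => [|t]; first by rewrite /row_a !gap_gf0 mulr1.
apply: (@lreg_1subXn _ t); rewrite mulrCA !gap_gfS mulr_sumr.
apply: eq_bigr => c _; rewrite [(n <= c)%N]leqNgt ltn_ord leq0n.
by rewrite muln1 muln0; ring.
Qed.

Lemma row_b_scale t : row_b n t = fpsX ^+ t * row_b 0 t.
Proof.
case: t => [|t]; first by rewrite /row_b !gap_gf0 mulr1.
apply: (@lreg_1subXn _ t); rewrite mulrCA !gap_gfS mulr_sumr.
apply: eq_bigr => c _; rewrite ltn_ord ltn0.
by rewrite muln1 muln0; ring.
Qed.

Lemma row_a_system : row_system fpsX (fun i => fpsC (w i)) row_a.
Proof.
split; [by move=> i; apply: gap_gf0|exact: row_aS|exact: row_a_scale].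
Qed.

(** The recursion of [row_b] descends in [k], so the colours are reversed. *)
Lemma row_b_system :
  row_system fpsX (fun i => fpsC (w (rev_ord i))) (fun i => row_b (n - i)).
Proof.
split=> [i|i t|t]; first exact: gap_gf0; last by rewrite subnn subn0 row_b_scale.
have e : (n - i = (rev_ord i).+1)%N by rewrite /= subnSK.
by rewrite -[(n - i.+1)%N]/(nat_of_ord (rev_ord i)) row_bS -e.
Qed.

End RowGF.

(** * Powers of x in the infinite products *)

Section GroupAlgebraCoef.
Variables (K : comNzRingType) (G : zmodType).
Implicit Types (f g : galg K G) (k : G).

Lemma gcoefM (r : seq G) f g k : uniq r ->
  (forall i, i \notin r -> gcoef i f * gcoef (k - i) g = 0) ->
  gcoef k (f * g) = \sum_(i <- r) gcoef i f * gcoef (k - i) g.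
Proof.
move=> ur fgr.
have -> : gcoef k (f * g) = \sum_(i <- msupp f) gcoef i f * gcoef (k - i) g.
  rewrite -[f * g]/(gmul f g) /gmul raddf_sum; apply: eq_bigr => i _ /=.
  rewrite raddf_sum /= [in RHS](galgE g) raddf_sum mulr_sumr; apply: eq_bigr => l _ /=.
  rewrite !gcoef_mon mulrnAr; congr (_ *+ _).
  by rewrite eq_sym [in RHS]eq_sym subr_eq addrC.
rewrite [LHS](bigID (mem r)) /= [X in _ + X]big1 ?addr0 => [|i /fgr //].
rewrite [RHS](bigID (mem (msupp f))) /= [X in _ = _ + X]big1 ?addr0 => [|i]; last first.
  by move/gcoef_out ->; rewrite mul0r.
rewrite -big_filter -[RHS]big_filter; apply: perm_big; apply: uniq_perm.
- by rewrite filter_uniq // fset_uniq.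
- by rewrite filter_uniq.
by move=> i; rewrite !mem_filter andbC.
Qed.

End GroupAlgebraCoef.

Lemma prod_qpochS (R : comNzRingType) (a x : R) N :
  \prod_(j < N.+1) (1 - a * x ^+ j) = (1 - a) * \prod_(j < N) (1 - a * x * x ^+ j).
Proof.
rewrite big_ord_recl expr0 mulr1; congr (_ * _).
by apply: eq_bigr => j _; rewrite exprS mulrA.
Qed.

Lemma prod_ord_ltS (R : comNzRingType) n (F : 'I_n -> R) (i : 'I_n) :
  \prod_(l < n | (l < i.+1)%N) F l = F i * \prod_(l < n | (l < i)%N) F l.
Proof.
rewrite (bigD1 i) //=; congr (_ * _).
by apply: eq_bigl => l; rewrite ltnS [RHS]ltn_neqAle val_eqE andbC.
Qed.

Lemma fps_cvg_le (R : comNzRingType) (F : nat -> fps R) (f : fps R) m : fps_cvg F f ->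
  exists N0, forall N, (N0 <= N)%N -> forall j, (j <= m)%N -> fcoef (F N) j = fcoef f j.
Proof.
move=> Ff; elim: m => [|m [N1 IH]].
  by have [N0 FN] := Ff 0; exists N0 => N /FN FN0 j; rewrite leqn0 => /eqP ->.
have [N2 FN] := Ff m.+1; exists (maxn N1 N2) => N; rewrite geq_max => /andP[le1 le2] j.
by rewrite leq_eqVlt => /orP[/eqP ->|]; [apply: FN|rewrite ltnS; apply: IH].
Qed.

(** * Series in powers of x of one sign *)

Section OneSided.
Variables (K : comNzRingType) (e : int).
Hypothesis e0 : e != 0.
Local Notation X := (galg K int).
Implicit Types (f g h : fps X).

(** Under this condition coefficients of x multiply by a finite Cauchy product. The two families of
    products use e = 1 and e = -1. *)
Definition one_sided f : Prop :=
  forall m k, gcoef k (fcoef f m) != 0 -> exists t : nat, k = e * t%:Z.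

Definition xcoef (t : nat) f : fps K := fps_map (gcoef (e * t%:Z)) f.

Lemma gcoefM_one_sided f g m m' (t : nat) : one_sided f -> one_sided g ->
  gcoef (e * t%:Z) (fcoef f m * fcoef g m') =
  \sum_(i < t.+1) gcoef (e * i%:Z) (fcoef f m) * gcoef (e * (t - i)%:Z) (fcoef g m').
Proof.
move=> sf sg; rewrite (@gcoefM _ _ [seq e * i%:Z | i <- iota 0 t.+1]).
- rewrite big_map -[iota 0 _]/(index_iota 0 t.+1) big_mkord; apply: eq_bigr => i _.
  by rewrite -mulrBr subzn // -ltnS.
- by rewrite map_inj_uniq ?iota_uniq // => i j /(mulfI e0) [].
move=> k kr; have [->|] := eqVneq (gcoef k (fcoef f m)) 0; first by rewrite mul0r.
move=> /sf[i ek]; have [->|] := eqVneq (gcoef (e * t - k) (fcoef g m')) 0.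
  by rewrite mulr0.
move=> /sg[j]; rewrite ek -mulrBr => /(mulfI e0) /(canRL (subrK _)) te.
case/negP: kr; rewrite ek; apply/mapP; exists i => //.
by rewrite mem_iota add0n ltnS -(@lez_nat i t) te lerDr.
Qed.

Lemma one_sidedM f g : one_sided f -> one_sided g -> one_sided (f * g).
Proof.
move=> sf sg m k; rewrite fcoefM raddf_sum /= => nz.
have [i nzi] : exists i : 'I_m.+1, gcoef k (fcoef f i * fcoef g (m - i)) != 0.
  apply/existsP; apply: contraNT nz => /existsPn nz; rewrite big1 // => i _.
  by apply/eqP; have := nz i; rewrite negbK.
move: nzi; rewrite (@gcoefM _ _ (msupp (fcoef f i))) ?fset_uniq //; last first.
  by move=> l /gcoef_out ->; rewrite mul0r.
move=> nzi.
have [l nzl] : exists l, gcoef l (fcoef f i) * gcoef (k - l) (fcoef g (m - i)) != 0.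
  apply: contrapT => /forallNP nzl; case/negP: nzi; rewrite big1 // => l _.
  by apply/eqP; have /negP := nzl l; rewrite negbK.
have /sf[t lE] : gcoef l (fcoef f i) != 0.
  by apply: contraNneq nzl => ->; rewrite mul0r.
have /sg[t' klE] : gcoef (k - l) (fcoef g (m - i)) != 0.
  by apply: contraNneq nzl => ->; rewrite mulr0.
exists (t' + t)%N; rewrite PoszD mulrDr -klE -lE.
by rewrite subrK.
Qed.

Lemma xcoefM t f g : one_sided f -> one_sided g ->
  xcoef t (f * g) = \sum_(i < t.+1) xcoef i f * xcoef (t - i) g.
Proof.
move=> sf sg; apply: fpsP => m; rewrite fcoef_sum.
rewrite -[LHS]/(gcoef (e * t%:Z) (fcoef (f * g) m)) fcoefM raddf_sum /=.
rewrite exchange_big /=; apply: eq_bigr => i _.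
exact: gcoefM_one_sided.
Qed.

Lemma gcoef1 k : gcoef k (1 : X) = (k == 0)%:R.
Proof. by rewrite -[1 in LHS]/(gmon 1 0) gcoef_mon eq_sym. Qed.

Lemma one_sided1 : one_sided 1.
Proof.
move=> m k; rewrite -[fcoef 1 m]/(1 *+ (m == 0)%N) raddfMn /= gcoef1 -mulrnA.
by have [->|_] := eqVneq k 0; [exists 0%N; rewrite mulr0|rewrite mul0n eqxx].
Qed.

Lemma xcoef1 t : xcoef t 1 = (t == 0)%:R.
Proof.
apply: fpsP => m; rewrite -[LHS]/(gcoef (e * t%:Z) (1 *+ (m == 0)%N)) raddfMn /= gcoef1.
rewrite mulf_eq0 (negPf e0) /= eqz_nat; case: eqP => _ //=; by rewrite mul0rn.
Qed.

Definition normalized h : Prop := one_sided h /\ xcoef 0 h = 1.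

Lemma normalizedM f g : normalized f -> normalized g -> normalized (f * g).
Proof.
move=> [sf f0] [sg g0]; split; first exact: one_sidedM.
by rewrite xcoefM // big_ord1 f0 g0 mulr1.
Qed.

Lemma normalized1 : normalized 1.
Proof. by split; [apply: one_sided1|rewrite xcoef1]. Qed.

Lemma normalized_prod (I : Type) (r : seq I) (P : pred I) (F : I -> fps X) :
  (forall i, P i -> normalized (F i)) -> normalized (\prod_(i <- r | P i) F i).
Proof.
by move=> FN; elim/big_ind: _ => //; [apply: normalized1|apply: normalizedM].
Qed.

(* (h', h) stands for (F(x^e q), F(x^e)) with F a power series and F(0) = 1. *)
Definition scaled h' h : Prop :=
  [/\ normalized h', normalized h & forall t, xcoef t h' = fpsX ^+ t * xcoef t h].

Lemma scaledM f' f g' g : scaled f' f -> scaled g' g -> scaled (f' * g') (f * g).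
Proof.
move=> [nf' nf fS] [ng' ng gS]; split; try exact: normalizedM.
case: nf' nf ng' ng => sf' _ [sf _] [sg' _] [sg _].
move=> t; rewrite !xcoefM // mulr_sumr; apply: eq_bigr => i _.
rewrite fS gS mulrACA -exprD subnKC //.
by rewrite -ltnS.
Qed.

Lemma scaled1 : scaled 1 1.
Proof.
split; try exact: normalized1.
by move=> [|t]; rewrite xcoef1 ?mulr1 // mulr0.
Qed.

Lemma scaled_prod (I : Type) (r : seq I) (P : pred I) (F' F : I -> fps X) :
  (forall i, P i -> scaled (F' i) (F i)) ->
  scaled (\prod_(i <- r | P i) F' i) (\prod_(i <- r | P i) F i).
Proof.
move=> FS; elim/big_rec2: _ => [|i h h' Pi hh']; first exact: scaled1.
by apply: scaledM => //; apply: FS.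
Qed.

(** Each coefficient of a limit is attained at a finite stage; the factor q^t calls for one stage
    serving all orders up to m. *)
Lemma scaled_lim (F' F : nat -> fps X) f' f :
  (forall N, scaled (F' N) (F N)) -> fps_cvg F' f' -> fps_cvg F f -> scaled f' f.
Proof.
move=> FS cF' cF.
have cF2 m : exists N, forall j, (j <= m)%N ->
    fcoef (F' N) j = fcoef f' j /\ fcoef (F N) j = fcoef f j.
  have [N' h'] := fps_cvg_le m cF'; have [N h] := fps_cvg_le m cF.
  by exists (maxn N' N) => j le_jm; rewrite h' ?leq_maxl // h ?leq_maxr.
have one_lim (H : nat -> fps X) h : (forall N, normalized (H N)) ->
    (forall m, exists N, fcoef (H N) m = fcoef h m) -> normalized h.
  move=> HN cH; split.
    by move=> m k; have [N <-] := cH m; case: (HN N) => s _; apply: s.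
  by apply: fpsP => m; have [N eN] := cH m; have [_ <-] := HN N; rewrite /xcoef /= eN.
split.
- apply: one_lim (fun N => let: And3 s _ _ := FS N in s) _ => m.
  by have [N /(_ m (leqnn m))[e' _]] := cF2 m; exists N.
- apply: one_lim (fun N => let: And3 _ s _ := FS N in s) _ => m.
  by have [N /(_ m (leqnn m))[_ e']] := cF2 m; exists N.
move=> t; apply: fpsP => m; have [N eN] := cF2 m; have [_ _ s] := FS N.
transitivity (fcoef (xcoef t (F' N)) m).
  by rewrite /xcoef /= (eN m (leqnn m)).1.
rewrite s !fcoefXnM; case: ifP => // _.
by rewrite /xcoef /= (eN _ (leq_subr _ _)).2.
Qed.

Variable n : nat.
Variable c : 'I_n -> K.

(** The sign turns the factors of [qpoch_inf] into 1 + x^e c_l q^j. *)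
Definition xterm (l : 'I_n) : fps X := fpsC (- gmon (c l) e).

(** Interpolates between the full product at x^e q ([i = 0]) and at x^e ([i = n]), one factor 1 +
    x^e c_l at a time. *)
Definition partial_product (i : nat) : fps X :=
  \prod_(l < n | (l < i)%N) (1 - xterm l) * \prod_(l < n) qpoch_inf (xterm l * fpsX).

Lemma xcoef_1subXM l t (h : fps X) : one_sided h ->
  xcoef t ((1 - xterm l) * h) =
  xcoef t h + (if t is t'.+1 then fpsC (c l) * xcoef t' h else 0).
Proof.
move=> sh; apply: fpsP => m; rewrite mulrBl mul1r fcoefD.
rewrite -[LHS]/(gcoef (e * t%:Z) (fcoef (h - xterm l * h) m)) fcoefB fcoefCM.
rewrite mulNr opprK raddfD /=; congr (_ + _).
rewrite (@gcoefM _ _ [:: e]) // => [|i]; last first.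
  by rewrite inE gcoef_mon eq_sym => /negPf ->; rewrite mul0r.
rewrite big_seq1 gcoef_mon eqxx mulr1n.
case: t => [|t]; last by rewrite fcoefCM -[t.+1]addn1 PoszD mulrDr mulr1 addrK.
rewrite mulr0 sub0r; have [->|/sh[j]] := eqVneq (gcoef (- e) (fcoef h m)) 0.
  by rewrite mulr0.
move/eqP; rewrite -[- e]mulrN1 => /eqP /(mulfI e0) /eqP.
by case: j.
Qed.

Lemma gcoef_factor l j m k : gcoef k (fcoef (1 - xterm l * fpsX ^+ j) m) =
  (k == 0)%:R *+ (m == 0)%N + c l *+ (k == e) *+ (m == j)%N.
Proof.
rewrite fcoefB fcoefMX raddfB /=; congr (_ + _).
  by rewrite raddfMn /= gcoef1.
case: ltngtP => [_|lt_jm|->]; first by rewrite raddf0 oppr0 mulr0n.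
  by rewrite /= subn_eq0 leqNgt lt_jm !mulr0n raddf0 oppr0.
by rewrite subnn eqxx !mulr1n raddfN opprK /= gcoef_mon eq_sym.
Qed.

Lemma one_sided_factor l j : one_sided (1 - xterm l * fpsX ^+ j).
Proof.
move=> m k; rewrite gcoef_factor.
have [->|_] := eqVneq k 0; first by exists 0%N; rewrite mulr0.
have [->|_] := eqVneq k e; first by exists 1%N; rewrite mulr1.
by rewrite !mul0rn addr0 eqxx.
Qed.

Lemma xcoef_factor l j t : xcoef t (1 - xterm l * fpsX ^+ j) =
  (t == 0)%:R + (fpsC (c l) * fpsX ^+ j) *+ (t == 1).
Proof.
apply: fpsP => m; rewrite -[LHS]/(gcoef (e * t%:Z) _) gcoef_factor fcoefD.
have -> : (e * t%:Z == e) = (t == 1)%N.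
  by rewrite -{2}[e]mulr1 (inj_eq (mulfI e0)).
rewrite mulf_eq0 (negPf e0) /= eqz_nat; congr (_ + _).
  by case: eqP => _; [|rewrite mul0rn].
case: eqP => _; last by rewrite !mulr0n mul0rn.
rewrite !mulr1n fcoefMX; case: ltngtP => [_|lt_jm|->] //.
  by rewrite /= subn_eq0 leqNgt lt_jm.
by rewrite subnn.
Qed.

Lemma normalized_factor l j : normalized (1 - xterm l * fpsX ^+ j).
Proof. by split; [apply: one_sided_factor|rewrite xcoef_factor addr0]. Qed.

Lemma scaled_factor l j :
  scaled (1 - xterm l * fpsX ^+ j.+1) (1 - xterm l * fpsX ^+ j).
Proof.
split; try exact: normalized_factor.
move=> t; rewrite [LHS]xcoef_factor [X in _ = _ * X]xcoef_factor.
case: t => [|[|t]].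
- by rewrite expr0 mul1r.
- by rewrite !mulr0n !add0r !mulr1n expr1 exprS mulrCA.
by rewrite !mulr0n !addr0 mulr0.
Qed.

Lemma fps_cvg_qpoch (a : fps X) :
  fps_cvg (fun N => \prod_(j < N) (1 - a * fpsX ^+ j)) (qpoch_inf a).
Proof. by rewrite /qpoch_inf (fps_limE (qpoch_infP a)); apply: qpoch_infP. Qed.

Lemma qpoch_infS (a : fps X) : qpoch_inf a = (1 - a) * qpoch_inf (a * fpsX).
Proof.
apply: (fps_cvg_unique (fps_cvg_qpoch a)) => m.
have [N1 cN] := fps_cvg_le m (fps_cvg_qpoch (a * fpsX)).
exists N1.+1 => -[//|N] le_N1N; rewrite prod_qpochS.
by apply: fcoefM_eqr => j le_jm; apply: cN.
Qed.

Lemma scaled_qpoch l : scaled (qpoch_inf (xterm l * fpsX)) (qpoch_inf (xterm l)).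
Proof.
apply: scaled_lim (fps_cvg_qpoch _) (fps_cvg_qpoch _) => N.
apply: scaled_prod => j _; rewrite -mulrA -exprS; exact: scaled_factor.
Qed.

Lemma partial_product0 :
  partial_product 0 = \prod_(l < n) qpoch_inf (xterm l * fpsX).
Proof. by rewrite /partial_product big_pred0 ?mul1r. Qed.

Lemma partial_productn : partial_product n = \prod_(l < n) qpoch_inf (xterm l).
Proof.
rewrite /partial_product (eq_bigl xpredT) => [|l]; last by rewrite ltn_ord.
by rewrite -big_split /=; apply: eq_bigr => l _; rewrite -qpoch_infS.
Qed.

Lemma partial_productS (i : 'I_n) :
  partial_product i.+1 = (1 - xterm i) * partial_product i.
Proof.
by rewrite /partial_product prod_ord_ltS -[LHS]mulrA.
Qed.

Lemma partial_product_scaled :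
  scaled (partial_product 0) (partial_product n).
Proof.
rewrite partial_product0 partial_productn.
by apply: scaled_prod => l _; apply: scaled_qpoch.
Qed.

Lemma normalized_partial_product i : normalized (partial_product i).
Proof.
apply: normalizedM; apply: normalized_prod => l _; last by case: (scaled_qpoch l).
by rewrite -[xterm l]mulr1 -[1 in X in _ * X](expr0 fpsX); apply: normalized_factor.
Qed.

Lemma partial_product_system :
  row_system fpsX (fun i => fpsC (c i)) (fun i t => xcoef t (partial_product i)).
Proof.
split=> [i|i t|t]; last by case: partial_product_scaled.
  by case: (normalized_partial_product i).
by rewrite partial_productS xcoef_1subXM //; case: (normalized_partial_product i).
Qed.

End OneSided.

(** The coefficient of x^0 pairs x^t in [f] with x^(-t) in [g]; the factor q^t leaves only t <= m at
    q^m. *)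
Lemma fcoef_coefx0M n (f g : fps (xlaurent n)) (u v : nat -> fps (laurent n)) m :
  one_sided 1 f -> one_sided (-1) g ->
  (forall t, xcoef 1 t f = fpsX ^+ t * u t) -> (forall t, xcoef (-1) t g = v t) ->
  fcoef (coefx0 (f * g)) m = \sum_(t < m.+1) fcoef (fpsX ^+ t * (u t * v t)) m.
Proof.
move=> sf sg fu gv; rewrite -[LHS]/(gcoef 0 (fcoef (f * g) m)) fcoefM raddf_sum.
under [RHS]eq_bigr => t _ do rewrite mulrA -fu -gv fcoefM.
rewrite [RHS]exchange_big /=; apply: eq_bigr => i _.
rewrite (@gcoefM _ _ [seq t%:Z | t <- iota 0 m.+1]).
- rewrite big_map -[iota 0 _]/(index_iota 0 m.+1) big_mkord; apply: eq_bigr => t _.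
  by rewrite /= mul1r mulN1r sub0r.
- by rewrite map_inj_uniq ?iota_uniq // => x y [].
move=> k kr; have [->|] := eqVneq (gcoef k (fcoef f i)) 0; first by rewrite mul0r.
move=> nz; have [t] := sf _ _ nz; rewrite mul1r => kt.
suff lt_it : (i < t)%N.
  have := congr1 (fun h => fcoef h i) (fu t).
  by rewrite fcoefXnM lt_it /= mul1r -kt => /eqP; rewrite (negPf nz).
rewrite ltnNge; apply: contra kr => le_ti; rewrite kt.
by rewrite mem_map ?mem_iota ?add0n ?(leq_ltn_trans le_ti) // => x y [].
Qed.

(** * From counts to weighted sums *)

Definition laurent_mon n (u v : {ffun 'I_n -> nat}) : laurent n :=
  \prod_(i < n) avar i ^ ((u i)%:Z - (v i)%:Z).

(** Group the objects of weight m by [st]: each class contributes its cardinality times one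
    monomial, and indices that are not attained contribute 0. *)
Lemma fcoef_fps_sum_gf n (T : choiceType) (A : set T) (wt : T -> nat)
    (su sv : T -> {ffun 'I_n -> nat})
    (Cnt : nat -> {ffun 'I_n -> nat} -> {ffun 'I_n -> nat} -> nat) m :
  (forall m u v,
     Cnt m u v = ncard [set x | [/\ A x, wt x = m, su x = u & sv x = v]]) ->
  finite_set [set x | A x /\ wt x = m] ->
  fcoef (fps_sum (gf_term Cnt)) m =
  \sum_(x <- fset_set [set x | A x /\ wt x = m]) laurent_mon (su x) (sv x).
Proof.
set L := [set x | _] => CntE fL.
pose st x : mindex n := (wt x, su x, sv x).
have fLj u v : finite_set [set x | [/\ A x, wt x = m, su x = u & sv x = v]].
  by apply: sub_finite_set fL => x [].
rewrite (partition_big_imfset _ st) /=.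
rewrite (@fsbigE _ _ _ _ _ [fset st x | x in fset_set L]%fset) //=; last first.
- move=> [[m' u] v] _ nr; rewrite fcoef_gf_term CntE.
  have [mE|] := eqVneq m m'; last by rewrite mulr0n.
  rewrite /ncard (_ : [set x | _] = set0) ?fset_set0 ?cardfs0 ?mul0rn //.
  apply/seteqP; split=> // x [Ax wx ux vx]; case/negP: nr.
  apply/imfsetP; exists x; last by rewrite /st wx ux vx.
  by rewrite /= in_fset_set // inE; split=> //; rewrite mE.
apply: eq_big => [j|[[m' u] v]]; first by rewrite in_setT.
move=> _; rewrite fcoef_gf_term CntE.
have [<-|ne_m] := eqVneq m m'; last first.
  rewrite mulr0n big_seq_cond big_pred0 // => x; rewrite in_fset_set //.
  apply/negbTE/negP => /andP[]; rewrite inE => -[_ wx] /eqP[wx' _ _].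
  by rewrite -wx -wx' eqxx in ne_m.
rewrite (@sum_fset_set_uniq _ _ _ _
  (fset_set [set x | [/\ A x, wt x = m, su x = u & sv x = v]])) //; first last.
- move=> x; rewrite in_fset_set // inE.
  split=> [[Ax wx ux vx]|[[Ax wx] /eqP[_ ux vx]]] //.
  by split=> //; rewrite /st wx ux vx.
rewrite [RHS]big_seq [in RHS](eq_bigr (fun=> laurent_mon u v)) => [|x]; last first.
  by rewrite in_fset_set // inE => -[_ _ -> ->].
by rewrite -[in RHS]big_seq big_const_seq count_predT iter_addr_0 mulr1n.
Qed.

Lemma prod_expr_count (R : comNzRingType) n (T : Type) (r : seq T) (f : T -> 'I_n)
    (x : 'I_n -> R) :
  \prod_(i < n) x i ^+ count (fun p => f p == i) r = \prod_(p <- r) x (f p).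
Proof.
elim: r => [|p r IHr]; first by rewrite big_nil big1.
rewrite big_cons -IHr /=; under eq_bigr => i _ do rewrite exprD.
rewrite big_split (bigD1 (f p)) //= eqxx expr1 big1 ?mulr1 // => i.
by rewrite eq_sym => /negPf ->.
Qed.

Lemma laurent_monE n (T U : Type) (r : seq T) (r' : seq U) (f : T -> 'I_n)
    (g : U -> 'I_n) :
  laurent_mon [ffun i => count (fun p => f p == i) r]
              [ffun i => count (fun p => g p == i) r'] =
  \prod_(p <- r) avar (f p) * \prod_(p <- r') (avar (g p))^-1.
Proof.
have ua (i : 'I_n) : avar i \is a GRing.unit.
  by apply: (@gunitPl _ _ _ (avar i)^-1); rewrite avarV gmonM mulr1 addNr.
rewrite -(prod_expr_count r f (@avar n)) -(prod_expr_count r' g (fun i => (avar i)^-1)).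
rewrite -big_split; apply: eq_bigr => i _.
by rewrite !ffunE exprzDr // -exprz_inv.
Qed.

(** * Coefficients of q^m of both counting series *)

Section Assembly.
Variable n : nat.
Local Notation a := (@avar n).
Local Notation K := (laurent n).

Definition ainv (i : 'I_n) : K := (a i)^-1.

(** Truncated subtraction is harmless: each subtracted indicator implies the one it is subtracted
    from. *)
Definition gap_P (c c' : colour n) : nat :=
  ((c'.1 <= c.1) - ((c.1 == c.2) && (c.2 == c'.1))
   + ((c.2 <= c'.2) - ((c.2 == c'.1) && (c'.1 == c'.2))))%N.

Lemma DeltaE (c c' : colour n) : Delta c c' = (gap_P c c')%:Z.
Proof.
case: c c' => i k [i' k']; rewrite /Delta /gap_P /chi /=.
have [->|_] := eqVneq i k; have [->|_] := eqVneq k i'; have [->|_] := eqVneq i' k';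
  rewrite ?leqnn /=; lia.
Qed.

Definition colour_val (c : colour n) : K := a c.1 * (a c.2)^-1.

(** Group by the number of parts, at most m. As gaps are nonnegative, positivity of all parts is
    that of the last one, hence the bound 1. *)
Lemma sum_P_level m :
  fcoef (fps_sum (gf_term (@Pcount n))) m =
  \sum_(s < m.+1) fcoef (gap_gf gap_P colour_val s (fun=> 1%N)) m.
Proof.
rewrite (@fcoef_fps_sum_gf _ _ (fun l => is_Pn l) (@Pn_weight n)
  (@Pn_count_a n) (@Pn_count_b n)) //; last exact: Plevel_finite.
pose L := [set l : seq (nat * colour n) | is_Pn l /\ Pn_weight l = m].
have size_le l : l \in fset_set L ->
    (size l < m.+1)%N.
  rewrite in_fset_set; last exact: Plevel_finite.
  rewrite inE => -[/andP[pos _] <-]; rewrite ltnS -sum1_size /Pn_weight !big_seq.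
  by apply: leq_sum => p /(allP pos).
rewrite big_seq (partition_big (fun l => inord (size l) : 'I_m.+1) xpredT) //=.
apply: eq_bigr => s _; rewrite -big_seq_cond.
rewrite (@sum_fset_set_uniq _ _ _ _
  (fset_set (gap_lists gap_P s (fun=> 1%N) m))); first last.
- move=> l; rewrite in_fset_set; last exact: gap_lists_finite.
  have srtE : sorted (fun p p' : nat * colour n => Delta p.2 p'.2 <= p.1%:Z - p'.1%:Z) l
      = sorted (gap_rel gap_P) l.
    by apply: eq_sorted => p p'; rewrite /gap_rel DeltaE lerBrDr.
  rewrite inE; split=> [[sl srt lg wl]|[[/andP[pos srt] wl] /eqP szl]].
    split; last by rewrite sl inord_val.
    split=> //; apply/andP; split; last by rewrite srtE.
    apply/allP => p pl; case/lastP: l pl {sl wl srtE} srt lg => // l z pl srt.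
    rewrite last_ge_rcons => z0; move: pl; rewrite mem_rcons inE => /orP[/eqP -> //|pl].
    exact: leq_trans z0 (sorted_rcons_ge srt pl).
  split=> //; first last.
  - case/lastP: l pos {srt wl szl srtE} => // l z; rewrite last_ge_rcons all_rcons.
    by case/andP.
  - by rewrite -srtE.
  rewrite -szl inordK //; apply: size_le.
  rewrite in_fset_set ?inE; last exact: Plevel_finite.
  by split=> //; apply/andP.
- exact: fset_uniq.
- exact: Plevel_finite.
rewrite /=; apply: eq_bigr => l _.
by rewrite laurent_monE -big_split.
Qed.

Lemma last_ge0 (C : finType) (theta : C -> nat) (l : seq (nat * C)) :
  (forall c, theta c = 0%N) -> last_ge theta l.
Proof. by case: l => //= p l ->. Qed.

(** Group by the number [t] of columns and the weight [i] of the upper row: the lower row has weight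
    m - t - i, and each fibre is a product of two sets of rows. *)
Lemma sum_F_level m :
  fcoef (fps_sum (gf_term (@Fcount n))) m =
  \sum_(t < m.+1) fcoef (fpsX ^+ t * (row_a a n t * row_b ainv 0 t)) m.
Proof.
rewrite (@fcoef_fps_sum_gf _ _ (fun f => is_frob f) (@frob_weight n)
  (@frob_count_a n) (@frob_count_b n)) //; last exact: Flevel_finite.
pose L := [set f : frob n | is_frob f /\ frob_weight f = m].
pose h (f : frob n) : 'I_m.+1 * 'I_m.+1 := (inord (size f.1), inord (list_weight f.1)).
have h_le f : f \in fset_set L ->
    (size f.1 + list_weight f.1 <= m)%N.
  rewrite in_fset_set; last exact: Flevel_finite.
  by rewrite inE => -[_ <-]; rewrite /frob_weight leq_addr.
have hE f : f \in fset_set L ->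
    (h f).1 = size f.1 :> nat /\ (h f).2 = list_weight f.1 :> nat.
  move=> /h_le le_m; rewrite /h /= !inordK // ltnS; apply: leq_trans le_m.
    by rewrite leq_addl.
  by rewrite leq_addr.
rewrite big_seq (partition_big h (fun x => x.1 + x.2 <= m)%N) //; last first.
  by move=> f fL; have [-> ->] := hE f fL; apply: h_le.
rewrite -(pair_big_dep xpredT (fun (t i : 'I_m.+1) => (t + i <= m)%N)
   (fun t i => \sum_(f <- fset_set L | (f \in fset_set L) && (h f == (t, i)))
      laurent_mon (frob_count_a f) (frob_count_b f))).
apply: eq_bigr => t _; rewrite fcoefXnM ltnNge -ltnS ltn_ord.
rewrite fcoefM.
pose G i := fcoef (row_a a n t) i * fcoef (row_b ainv 0 t) (m - t - i).
have -> : \sum_(i < (m - t).+1) G i = \sum_(i < m.+1 | (t + i <= m)%N) G i.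
  rewrite (big_ord_widen m.+1 G).
    by apply: eq_bigl => i; have := ltn_ord t; lia.
  by rewrite ltnS leq_subr.
apply: eq_bigr => i le_tim; rewrite -big_seq_cond.
pose LA := gap_lists (@gap_a n) t (fun l : 'I_n => (n <= l)%N : nat) i.
pose LB := gap_lists (@gap_b n) t (fun l : 'I_n => (l < 0)%N : nat) (m - t - i).
have fA : finite_set LA by apply: gap_lists_finite.
have fB : finite_set LB by apply: gap_lists_finite.
have srtA (l : seq (nat * 'I_n)) : sorted (@gt_a n) l = sorted (gap_rel (@gap_a n)) l.
  apply: eq_sorted => p p'; rewrite /gap_rel /gap_a /gt_a [(p.2 < _)%N]ltnNge.
  case: (p'.2 <= p.2)%N; first by rewrite andbF orbF.
  by rewrite andbT orbC add0n [RHS]leq_eqVlt.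
have srtB (l : seq (nat * 'I_n)) : sorted (@gt_b n) l = sorted (gap_rel (@gap_b n)) l.
  apply: eq_sorted => p p'; rewrite /gap_rel /gap_b /gt_b [(p'.2 < _)%N]ltnNge.
  case: (p.2 <= p'.2)%N; first by rewrite andbF orbF.
  by rewrite andbT orbC add0n [RHS]leq_eqVlt.
have lgA (l : seq (nat * 'I_n)) : last_ge (fun l : 'I_n => (n <= l)%N : nat) l.
  by apply: last_ge0 => c; rewrite leqNgt ltn_ord.
have lgB (l : seq (nat * 'I_n)) : last_ge (fun l : 'I_n => (l < 0)%N : nat) l.
  exact: last_ge0.
rewrite (@sum_fset_set_uniq _ _ _ _ 
  [seq (x, y) | x <- fset_set LA, y <- fset_set LB]); first last.
- move=> [x y]; split.
    move/allpairsP => [[x' y'] [/=]]; rewrite !in_fset_set // !inE.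
    move=> [sx ox _ wx] [sy oy _ wy] [-> ->].
    have wm : frob_weight (x', y') = m.
      rewrite /frob_weight /= -/(list_weight x') -/(list_weight y') sx wx wy; lia.
    have Fm : L (x', y').
      by split=> //; rewrite /is_frob /= sx sy eqxx srtA ox srtB oy.
    split=> //; have [] := hE (x', y').
      by rewrite in_fset_set ?inE //; apply: Flevel_finite.
    rewrite [size _]sx [list_weight _]wx; case: (h _) => t' i' e1 e2.
    by apply/eqP; congr (_, _); apply: val_inj.
  move=> [Fm /eqP hm]; have [] := hE (x, y).
    by rewrite in_fset_set ?inE //; apply: Flevel_finite.
  rewrite hm /= => sx wx; case: Fm => /and3P[/= /eqP exy ox oy].
  rewrite /frob_weight /= -/(list_weight x) -/(list_weight y) => wm.
  apply/allpairsP; exists (x, y); rewrite /= !in_fset_set // !inE; split=> //.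
    by split=> //; rewrite -?srtA.
  split=> //; rewrite -?srtB -?exy //; lia.
- by apply: allpairs_uniq; rewrite ?fset_uniq // => -[x y] [x' y'].
- exact: Flevel_finite.
rewrite /G big_allpairs_dep /= mulr_suml; apply: eq_bigr => x _.
rewrite mulr_sumr; apply: eq_bigr => y _.
exact: laurent_monE.
Qed.

End Assembly.

(** * Comparison of the three series *)

Section Final.
Variable n : nat.
Local Notation a := (@avar n).
Local Notation av := (@ainv n).

Lemma avar_mulV i : fpsC (a i) * fpsC (av i) = 1.
Proof.
rewrite -fpsCM -[1]/(fpsC 1); congr fpsC.
by rewrite /ainv avarV gmonM mulr1 subrr.
Qed.

(** Each half of the gap is 0 or 1, so its power is 1 or [y]; on the diagonal, adding 1 - y corrects
    [y] to 1. *)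
Lemma expr_gap_P (R : comNzRingType) (x : R) s (i k i' k' : 'I_n) (y := x ^+ s) :
  x ^+ (s * gap_P (i, k) (i', k')) =
  ((if (i' <= i)%N then y else 1) + (if (i == k) && (k == i') then 1 - y else 0)) *
  ((if (k <= k')%N then y else 1) + (if (k == i') && (i' == k') then 1 - y else 0)).
Proof.
rewrite /gap_P mulnDr exprD /=; congr (_ * _).
  have [eik|_] := eqVneq i k; have [eki|_] := eqVneq k i'; rewrite /= ?subn0 ?addr0.
    by rewrite eik eki leqnn muln0 addrC subrK.
  1-3: by case: leqP => _; rewrite ?muln1 ?muln0.
have [eki|_] := eqVneq k i'; have [eik|_] := eqVneq i' k'; rewrite /= ?subn0 ?addr0.
  by rewrite eki eik leqnn muln0 addrC subrK.
1-3: by case: leqP => _; rewrite ?muln1 ?muln0.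
Qed.

(** Both sides are 1 at s = 0 and obey the same recursion, by [gap_gfS] and [closed_form_rec]. *)
Lemma gap_P_gf s (i k : 'I_n) :
  gap_gf (@gap_P n) (@colour_val n) s (fun c => gap_P c (i, k)) =
  closed_form fpsX (row_a a) (row_b av) s i k.
Proof.
elim: s i k => [|s IHs] i' k'.
  by rewrite gap_gf0 (closed_form0 _ (@row_a0 _ _ a) (@row_b0 _ _ av)).
apply: (@lreg_1subXn _ s); rewrite gap_gfS.
rewrite (@closed_form_rec _ fpsX n _ _ avar_mulV _ _ (@row_a0 _ _ a) (@row_aS _ _ a)
  (@row_a_scale _ _ a) (@row_b0 _ _ av) (@row_bS _ _ av) (@row_b_scale _ _ av)).
transitivity (\sum_(k < n) \sum_(i < n) fpsC (colour_val (i, k)) *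
    (fpsX ^+ (s.+1 * gap_P (i, k) (i', k')) *
     closed_form fpsX (row_a a) (row_b av) s i k)).
  rewrite exchange_big pair_big; apply: eq_bigr => -[i k] _.
  by rewrite -IHs.
apply: eq_bigr => k _; rewrite mulr_sumr; apply: eq_bigr => i _.
by rewrite expr_gap_P fpsCM; ring.
Qed.

(** Every factor of [qfall] is 1 - q^r with r > N - t >= j, invisible at q^j. This realises the
    limit N -> oo. *)
Lemma fcoef_qfall N t (g : fps (laurent n)) j : (j + t <= N)%N ->
  fcoef (qfall fpsX N t * g) j = fcoef g j.
Proof.
elim: t g => [|t IHt] g le_N; first by rewrite qfall0 mul1r.
rewrite qfallSr -mulrA IHt; last by lia.
rewrite mulrBl mul1r fcoefB fcoefXnM ifT ?subr0 //; lia.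
Qed.

Lemma row_a_xcoef t :
  row_a a n t = xcoef 1 t (\prod_(l < n) qpoch_inf (xterm 1 a l)).
Proof.
have sp := @partial_product_system _ 1 isT n a.
rewrite -partial_productn.
exact: (@row_system_unique _ _ n (@lreg_1subXn _) _ _ _ n t
  (row_a_system a) sp (leqnn n)).
Qed.

Lemma row_b_xcoef t :
  row_b av 0 t = xcoef (-1) t (\prod_(l < n) qpoch_inf (xterm (-1) av l)).
Proof.
have sp := @partial_product_system _ (-1) isT n (fun i => av (rev_ord i)).
rewrite (reindex_inj rev_ord_inj) /= -partial_productn -(subnn n).
exact: (@row_system_unique _ _ n (@lreg_1subXn _) _ _ _ n t
  (row_b_system av) sp (leqnn n)).
Qed.

(** The bound 1 puts q^(s+1) on every colour, so [closed_form_total] gives the recursion required by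
    [sum_falling]. *)
Lemma sum_gap_P_gf N :
  \sum_(s < N.+1) gap_gf (@gap_P n) (@colour_val n) s (fun=> 1%N) =
  \sum_(t < N.+1) fpsX ^+ t * qfall fpsX N t * (row_a a n t * row_b av 0 t).
Proof.
apply: (@sum_falling _ _ (fun t => row_a a n t * row_b av 0 t)
  (fun s => gap_gf (@gap_P n) (@colour_val n) s (fun=> 1%N))) => [|s].
  by rewrite /row_a /row_b !gap_gf0 mulr1.
apply: (@lreg_1subXn _ s); rewrite gap_gfS muln1.
transitivity (fpsX ^+ s.+1 * \sum_(k < n) \sum_(i < n)
    fpsC (a i) * fpsC (av k) * closed_form fpsX (row_a a) (row_b av) s i k).
  rewrite exchange_big pair_big mulr_sumr; apply: eq_bigr => -[i k] _.
  by rewrite gap_P_gf fpsCM mulrCA.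
rewrite (@closed_form_total _ fpsX n _ _ avar_mulV _ _ (@row_aS _ _ a)
  (@row_a_scale _ _ a) (@row_b0 _ _ av) (@row_bS _ _ av) (@row_b_scale _ _ av)).
rewrite mulrCA; congr (_ * (_ * _)).
by apply: eq_bigr => t _; rewrite mulrA.
Qed.

Lemma xterm_pos i : fpsC (- (xvar n * xconst (a i))) = xterm 1 a i.
Proof. by rewrite /xterm gmonM mul1r addr0. Qed.

Lemma xterm_neg i : fpsC (- ((xvar n)^-1 * (xconst (a i))^-1)) = xterm (-1) av i.
Proof. by rewrite /xterm xvarV xconst_avarV gmonM mul1r addr0. Qed.

End Final.

Unset Implicit Arguments.

Theorem theorem1p29 (n : nat) (hn : (0 < n)%N) :
  fps_sum (gf_term (@Pcount n)) = fps_sum (gf_term (@Fcount n)) /\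
  fps_sum (gf_term (@Fcount n)) =
    coefx0 (\prod_(i < n)
      (qpoch_inf (fpsC (- (xvar n * xconst (avar i))) * fpsX)
       * qpoch_inf (fpsC (- ((xvar n)^-1 * (xconst (avar i))^-1))))).
Proof.
split; apply: fpsP => m; last rewrite [LHS]sum_F_level.
  (* N = m suffices: in term t only the coefficient at m - t is read, where [qfall] acts as 1. *)
  rewrite [LHS]sum_P_level [RHS]sum_F_level -fcoef_sum sum_gap_P_gf fcoef_sum.
  apply: eq_bigr => t _.
  rewrite -mulrA [LHS]fcoefXnM [RHS]fcoefXnM ltnNge -ltnS ltn_ord.
  by apply: fcoef_qfall; rewrite subnK // -ltnS.
(* The extra q makes the first family the stage 0 product, which accounts for the factor q^t; the
   second is at stage [n]. *)
have -> : \prod_(i < n)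
      (qpoch_inf (fpsC (- (xvar n * xconst (avar i))) * fpsX)
       * qpoch_inf (fpsC (- ((xvar n)^-1 * (xconst (avar i))^-1)))) =
    partial_product 1 (@avar n) 0 * partial_product (-1) (@ainv n) n.
  rewrite partial_product0 partial_productn -big_split; apply: eq_bigr => i _.
  exact: (congr2 (fun u v => qpoch_inf (u * fpsX) * qpoch_inf v)
    (xterm_pos i) (xterm_neg i)).
have [[sf _] _ fS] := @partial_product_scaled _ 1 isT n (@avar n).
have [_ [sg _] _] := @partial_product_scaled _ (-1) isT n (@ainv n).
apply/esym; apply: fcoef_coefx0M sf sg _ _ => t.
  by rewrite fS partial_productn row_a_xcoef.
by rewrite partial_productn row_b_xcoef.
Qed.
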